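(* Every Taylor coefficient at $0$ of every Schur iterate $f_j$ ($j\ge0$) of $f$ is strictly negative. In particular, $$-1<\alpha_j<0\qquad(j\ge0).$$
   Context: Put $L=\log 2$. Let $\widehat\mu$ be the even probability measure on $[-1,1]$ with $\mathrm d\widehat\mu(x)=\frac1{\pi L}\frac{\arcsin x}{x}\,\mathrm dx$. Let $\sigma$ be its circle lift, that is, the distribution on the unit circle $\mathbb T$ of $e^{2i\arccos X}$ where $X$ has distribution $\widehat\mu$. Let $$\mathcal F(z)=\int_{\mathbb T}\frac{w+z}{w-z}\,\mathrm d\sigma(w),\qquad f(z)=\frac{\mathcal F(z)-1}{z(\mathcal F(z)+1)}\qquad(|z|<1)$$ be the associated Carathéodory function and Schur function (removable singularity at $z=0$). The Schur iterates $f_j$ and Schur parameters $\alpha_j$ (which are the Verblunsky coefficients of $\sigma$) are defined by $f_0=f$ and $$\alpha_j=f_j(0),\qquad f_{j+1}(z)=\frac{f_j(z)-\alpha_j}{z\bigl(1-\overline{\alpha_j}f_j(z)\bigr)}\qquad(j\ge0).$$ *)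

(* Defs.v *)
From HB Require Import structures.
From mathcomp Require Import all_boot all_order all_algebra.
From mathcomp Require Import complex.
From mathcomp Require Import all_classical all_reals all_analysis.
From mathcomp Require Import measurable_realfun.
From mathcomp Require Import ring lra.

Set Implicit Arguments.
Unset Strict Implicit.
Unset Printing Implicit Defensive.

Import Order.TTheory GRing.Theory Num.Theory.
Import numFieldNormedType.Exports.

Local Open Scope classical_set_scope.
Local Open Scope ring_scope.

(* R[i] repackaged as a numClosedFieldType: through this packaging (and not for
   the bare type R[i]) the norm topology of a numFieldType is inferred.  In its
   order, z < w means that 'Im z = 'Im w and 'Re z < 'Re w. *)
Definition Cx (R : realType) : numClosedFieldType := R[i]%C.

Definition BorelCx (R : realType) := g_sigma_algebraType (@open (Cx R)).

Section muhat.
Context {R : realType}.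
Implicit Types x : R.

(* At the single point x = 0 the quotient is 0 / 0 = 0 instead of its limit 1. *)
Definition muhat_density x : R := (pi * ln 2)^-1 * (asin x / x).

Lemma measurable_muhat_density : measurable_fun (`[-1, 1] : set R) muhat_density.
Proof.
apply: (@measurable_fun_itv_cc _ _ _ false true).
apply: measurable_funM => //; apply: measurable_funM => //.
  apply: open_continuous_measurable_fun => // x; rewrite inE/= in_itv/=.
  exact: continuous_asin.
apply: measurable_funTS.
rewrite -(setUv [set 0]); apply/measurable_funU => //.
  exact: measurableC.
split; first exact: measurable_fun_set1.
apply: open_continuous_measurable_fun.
  by apply: closed_openC; exact: closed_eq.
by move=> x; rewrite inE/= => /eqP; exact: inv_continuous.
Qed.

Lemma muhat_density_ge0 x : -1 <= x <= 1 -> 0 <= muhat_density x.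
Proof.
move=> x11; have a2 := asin_lepi2 x11; have a1 := asin_geNpi2 x11.
have ale : -(pi / 2) <= asin x <= pi / 2 by rewrite a1.
have sx : sin (asin x) = x by apply: asinK; rewrite in_itv.
apply: mulr_ge0; first by rewrite invr_ge0 mulr_ge0 ?pi_ge0 ?ln_ge0 ?ler1n.
have [x0|x0|->] := ltgtP x 0; last by rewrite invr0 mulr0.
- rewrite -mulrNN -invrN divr_ge0 ?oppr_ge0 ?(ltW x0)// leNgt.
  apply/negP => a0; have : 0 < sin (asin x).
    by rewrite sin_gt0_pi// a0/= (le_lt_trans a2)// ltr_pdivrMr// ltr_pMr ?pi_gt0// ltr1n.
  by rewrite sx ltNge (ltW x0).
- rewrite divr_ge0 ?(ltW x0)// leNgt.
  apply/negP => a0; have : 0 < sin (- asin x).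
    rewrite sin_gt0_pi// oppr_gt0 a0/=.
    by rewrite (@le_lt_trans _ _ (pi / 2))// 1?lerNl// ltr_pdivrMr// ltr_pMr ?pi_gt0// ltr1n.
  by rewrite sinN sx oppr_gt0 ltNge (ltW x0).
Qed.

Definition muhat (A : set (measurableTypeR R)) : \bar R :=
  (\int[lebesgue_measure]_(x in A `&` `[(-1)%R, 1%R]) (muhat_density x)%:E)%E.

Let muhat0 : muhat set0 = 0%E.
Proof. by rewrite /muhat set0I integral_set0. Qed.

Let muhat_ge0 A : (0 <= muhat A)%E.
Proof.
apply: integral_ge0 => x [_]; rewrite /= in_itv/= => x11.
by rewrite lee_fin muhat_density_ge0.
Qed.

Let muhat_sigma_additive : semi_sigma_additive muhat.
Proof.
move=> /= F mF tF mUF; apply: cvg_toP.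
  by apply: ereal_nondecreasing_is_cvgn => m n mn; exact: lee_sum_nneg_natr.
rewrite /muhat setI_bigcupl ge0_integral_bigcup//=.
- by move=> k; exact: measurableI.
- apply: measurable_funS (measurable_itv _) _ _; last first.
    apply/measurable_EFinP; exact: measurable_muhat_density.
  by move=> x [k _ []].
- by move=> x [k _ [_]]; rewrite /= in_itv/= lee_fin => /muhat_density_ge0.
- exact: trivIset_setIr.
Qed.

HB.instance Definition _ :=
  isMeasure.Build _ _ _ muhat muhat0 muhat_ge0 muhat_sigma_additive.

(* Outside [-1, 1], which is muhat-null, acos is constant. *)
Definition circle_lift x : BorelCx R :=
  (cos (2 * acos x) +i* sin (2 * acos x))%C.

Lemma continuous_Cx (u v : R -> R) : continuous u -> continuous v ->
  continuous (fun x => (u x +i* v x)%C : Cx R).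
Proof.
move=> cu cv x; apply/cvgrPdist_lt => /= e e0.
have [r r0 ->] : exists2 r, 0 < r & e = r%:C%C.
  by case: e e0 => a b; rewrite ltcE/= => /andP[/eqP-> a0]; exists a.
have r20 : 0 < r / 2 by rewrite divr_gt0.
have /cvgrPdist_lt/(_ _ r20) ux := cu x.
have /cvgrPdist_lt/(_ _ r20) vx := cv x.
near=> y.
have uy : `|u x - u y| < r / 2 by near: y.
have vy : `|v x - v y| < r / 2 by near: y.
rewrite normc_def/= ltcR -(ger0_norm (ltW r0)) -sqrtr_sqr ltr_sqrt ?exprn_gt0//.
rewrite (splitr r) -(real_normK (num_real (u x - u y))).
rewrite -(real_normK (num_real (v x - v y))).
have := normr_ge0 (u x - u y); have := normr_ge0 (v x - v y).
nra.
Unshelve. all: by end_near. Qed.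

Lemma circle_liftE x : circle_lift x =
  if -1 <= x <= 1 then ((x ^+ 2 *+ 2 - 1) +i* ((x * Num.sqrt (1 - x ^+ 2)) *+ 2))%C
  else circle_lift 2.
Proof.
case: ifPn => [x11|xN11].
  have cx : cos (acos x) = x by apply: acosK; rewrite in_itv.
  rewrite /circle_lift mulr_natl cos_mulr2n sin_mulr2n cx sin_acos//.
have acosE (y : R) : ~~ (-1 <= y <= 1) -> acos y = get set0.
  move=> yN11; rewrite acos.unlock; congr get; rewrite -subset0 => z [_ zy].
  by move: yN11; rewrite -zy cos_geN1 cos_le1.
by rewrite /circle_lift !acosE// lern1 andbF.
Qed.

Lemma measurable_circle_lift : measurable_fun setT circle_lift.
Proof.
rewrite (funext circle_liftE); apply: measurable_fun_ifT => //.
  by apply: measurable_and; apply: measurable_fun_ler.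
apply: (@measurability _ _ _ (BorelCx R) _ _ (@open (Cx R))) => // _ [B oB <-].
rewrite setTI; apply: open_measurable.
move: B oB; apply/continuousP; apply: continuous_Cx => x.
  by apply: cvgB; [apply: cvgMn; exact: exprn_continuous|exact: cvg_cst].
apply: cvgMn; apply: cvgM; first exact: cvg_id.
apply: continuous_comp; last exact: sqrt_continuous.
by apply: cvgB; [exact: cvg_cst|exact: exprn_continuous].
Qed.

Definition sigma : set (BorelCx R) -> \bar R := pushforward muhat circle_lift.

HB.instance Definition _ := Measure.copy sigma
  (measure_function_pushforward__canonical__measure_function_Measure
     muhat measurable_circle_lift).

End muhat.

Section schur.
Context {R : realType}.
Local Notation C := (Cx R).
Implicit Types (z : C) (g : C -> C).

Definition unit_circle : set (BorelCx R) := [set w : C | `|w| = 1].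

Definition Cx_integral d (T : measurableType d) (mu : {measure set T -> \bar R})
    (D : set T) (h : T -> C) : C :=
  ((\int[mu]_(w in D) complex.Re (h w)) +i*
   (\int[mu]_(w in D) complex.Im (h w)))%C.

Definition caratheodory z : C :=
  Cx_integral sigma unit_circle (fun w : C => (w + z) / (w - z)).

(* The limit is over y != 0. The function g is only relevant near 0 or on the
   unit disc, and the default value of a lim that does not exist is 0. *)
Definition remove_singularity g z : C :=
  if z == 0 then lim (g y @[y --> 0^']) else g z.

Definition schur_function : C -> C :=
  remove_singularity
    (fun z => (caratheodory z - 1) / (z * (caratheodory z + 1))).

Fixpoint schur_iterate (j : nat) : C -> C :=
  if j is i.+1 then
    let f := schur_iterate i in
    remove_singularity (fun z => (f z - f 0) / (z * (1 - (f 0)^* * f z)))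
  else schur_function.

Definition schur_parameter (j : nat) : C := schur_iterate j 0.

Definition taylor_coefficient g (n : nat) : C := derive1n n g 0 / n`!%:R.

End schur.

(* Main.v *)
(** Let [c n] be the [n]-th trigonometric moment of sigma, so that the
    Caratheodory function is [F(z) = 1 + 2 * sum_(n >= 1) c n * z^n].  If
    [c n < 0] for all [n >= 1] then [z f(z) = (F - 1) / (F + 1)] equals
    [1 - 1 / (1 - sum_(n >= 1) |c n| z^n)], so all Taylor coefficients of [f]
    are negative.  Negativity propagates: if [f = - g] with [g = sum a n * z^n],
    [a n > 0] and [sum a n <= 1], then the next iterate is
    [- (g - a 0) / (z (1 - a 0 * g))], the quotient of a series with positive
    coefficients by a series whose higher coefficients are negative, and its
    value at [z = 1] shows that the new coefficients again have sum at most 1;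
    in particular [0 < a 0 < 1].

    With [x = cos t], the integrand of [c n + c (n+1)] loses the factor [1 / x]
    and integrates explicitly to
    [c n + c (n+1) = (1 / (n+1) - 1 / n) / (2 ln 2)] for [n >= 1]. Hence
    [c (2n)] tends to [c 0 - 1] by the alternating harmonic series, while its
    arithmetic means tend to 0 because the averages of [cos (4nt)] do so almost
    everywhere.  This yields at once [c 0 = 1] (sigma is a probability measure)
    and [c n -> 0]; as [c n < c (n+2)] for [n >= 1], all these [c n] are
    negative. *)

From HB Require Import structures.
Require Import Defs.
From mathcomp Require Import all_boot all_order all_algebra.
From mathcomp Require Import complex.
From mathcomp Require Import all_classical all_reals all_analysis.
From mathcomp Require Import measurable_realfun.
From mathcomp Require Import ring lra.

Set Implicit Arguments.
Unset Strict Implicit.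
Unset Printing Implicit Defensive.

Import Order.TTheory GRing.Theory Num.Theory.
Import numFieldNormedType.Exports.

Local Open Scope classical_set_scope.
Local Open Scope ring_scope.

Local Arguments Cx : simpl never.

(** * Coefficients of quotients of power series *)

(** Each coefficient of the quotient depends on all earlier ones, so the recursion runs on the list
    of the coefficients found so far. *)
Lemma exists_quotient_coefs (K : fieldType) (d a : nat -> K) : d 0%N != 0 ->
  exists b : nat -> K, forall n, \sum_(j < n.+1) b j * d (n - j)%N = a n.
Proof.
move=> d0.
pose next (s : seq K) := (a (size s) -
  \sum_(j < size s) s`_j * d (size s - j)%N) / d 0%N.
pose bs n := iter n (fun s => rcons s (next s)) [::].
have size_bs n : size (bs n) = n by elim: n => //= n IH; rewrite size_rcons IH.
have nth_bs n m j : (j < n)%N -> (bs (n + m)%N)`_j = (bs n)`_j.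
  move=> jn; elim: m => [|m IH]; first by rewrite addn0.
  by rewrite addnS /= nth_rcons size_bs ltn_addr.
exists (fun n => (bs n.+1)`_n) => n.
rewrite big_ord_recr /= subnn nth_rcons size_bs ltnn eqxx /next size_bs.
rewrite divfK//; under eq_bigr => j _.
  rewrite -(nth_bs j.+1 (n - j.+1)%N)// subnKC//; over.
by rewrite addrC subrK.
Qed.

(** After the sums are exchanged, each [b j] multiplies a partial sum of [e]. The index [(n - j).-1]
    numbers from 0 the coefficients that follow the constant term of a denominator. *)
Lemma sum_convolution_le (R : realDomainType) (b e : nat -> R) (delta : R) N :
  (forall n, 0 <= b n) -> (forall n, 0 <= e n) ->
  (forall M, \sum_(i < M) e i <= delta) ->
  \sum_(n < N) \sum_(j < n) b j * e (n - j).-1 <= (\sum_(j < N) b j) * delta.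
Proof.
move=> b0 e0 ed.
under eq_bigr => n _.
  rewrite (big_ord_widen N (fun j => b j * e (n - j).-1)); last exact/ltnW.
  over.
rewrite (exchange_big_dep xpredT)//= mulr_suml; apply: ler_sum => j _.
rewrite -mulr_sumr; apply: ler_wpM2l => //.
apply: le_trans (ed N).
rewrite -(big_mkord (fun n => (j < n)%N) (fun n => e (n - j).-1)).
rewrite -(big_mkord xpredT e).
rewrite (@big_cat_nat _ _ _ j.+1 0 N)//= big_nat_cond big_pred0 ?add0r; last first.
  by move=> n; rewrite leq0n ltnS/=; case: leqP.
rewrite big_nat_cond -[X in \sum_(X <= i < _ | _) _]add0n big_addn.
rewrite (eq_bigl (fun i => (0 <= i < N - j.+1)%N)); last first.
  by move=> i; rewrite leq0n leq_addl andbT /= ltn_subRL addnC.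
rewrite -big_nat.
under eq_bigr => i _ do rewrite addnS subSn ?leq_addl//= addnK.
rewrite [leRHS](@big_cat_nat _ _ _ (N - j.+1) 0 N) ?leq_subr//=.
by rewrite lerDl sumr_ge0.
Qed.

(** With [e i = - d i.+1], the recursion [b n * d 0 = a n + \sum_(j < n) b j * e (n - j).-1] has no
    negative term. Summed over [n < N] it gives [S * d 0 <= d 0 - delta + S * delta] for the partial
    sum [S] of [b], and [d 0 - delta > 0] cancels. This is a finite form of evaluating the quotient
    at 1. *)
Lemma quotient_coefs_gt0_le1 (R : realFieldType) (d a : nat -> R) (delta : R) :
  (forall i, d i.+1 <= 0) -> (forall n, 0 < a n) ->
  (forall N, \sum_(i < N) - d i.+1 <= delta) -> delta < d 0%N ->
  (forall N, \sum_(n < N) a n <= d 0%N - delta) ->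
  exists b : nat -> R, [/\ forall n, 0 < b n,
    forall N, \sum_(n < N) b n <= 1 &
    forall n, \sum_(j < n.+1) b j * d (n - j)%N = a n].
Proof.
move=> d_le0 a_gt0 d_delta delta_d a_le.
have delta_ge0 : 0 <= delta by have := d_delta 0%N; rewrite big_ord0.
have d0 : 0 < d 0%N by exact: le_lt_trans delta_d.
have [b bE] := @exists_quotient_coefs _ d a (lt0r_neq0 d0).
pose e i := - d i.+1.
have dS n j : (j < n)%N -> d (n - j)%N = - e (n - j).-1.
  by move=> jn; rewrite /e opprK prednK// subn_gt0.
have bE' n : b n * d 0%N = a n + \sum_(j < n) b j * e (n - j).-1.
  rewrite -bE big_ord_recr/= subnn addrAC -big_split/= big1 ?add0r// => j _.
  by rewrite dS// mulrN addNr.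
have b_gt0 n : 0 < b n.
  elim/ltn_ind: n => n IH; rewrite -(pmulr_lgt0 _ d0) bE' ltr_wpDr//.
  by apply: sumr_ge0 => j _; rewrite mulr_ge0 ?oppr_ge0// ltW// IH.
exists b; split=> // N.
have : (\sum_(n < N) b n) * d 0%N <= d 0%N - delta + (\sum_(n < N) b n) * delta.
  rewrite mulr_suml; under eq_bigr do rewrite bE'.
  rewrite big_split/= lerD ?a_le//; apply: sum_convolution_le => // n.
    exact/ltW.
  by rewrite /e oppr_ge0.
have : 0 < d 0%N - delta by rewrite subr_gt0.
nra.
Qed.

(** * Power series germs over the complex numbers *)

Section real_modulus.
Context {R : realType}.
Local Notation C := (Cx R).
Implicit Types (x y : R) (z w : C).

Definition ofR x : C := (x%:C)%C.

Lemma ofR_is_nmod_morphism : nmod_morphism ofR.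
Proof. by split => [//|x y]; exact: rmorphD. Qed.

Lemma ofR_is_monoid_morphism : monoid_morphism ofR.
Proof. by split => [//|x y]; exact: rmorphM. Qed.

HB.instance Definition _ := GRing.isNmodMorphism.Build R C ofR ofR_is_nmod_morphism.
HB.instance Definition _ := GRing.isMonoidMorphism.Build R C ofR ofR_is_monoid_morphism.

(** The norm of [Cx R] takes its values in [Cx R] itself; a real-valued one opens the estimates to
    real arithmetic. *)
Definition modulus z : R := complex.Re `|z|.

Lemma modulusE z : `|z| = ofR (modulus z).
Proof. by rewrite /modulus /ofR normc_def. Qed.

Lemma ler_ofR x y : (ofR x <= ofR y) = (x <= y).
Proof. exact: lecR. Qed.

Lemma ltr_ofR x y : (ofR x < ofR y) = (x < y).
Proof. exact: ltcR. Qed.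

Lemma ofR_inj : injective ofR.
Proof. by move=> x y []. Qed.

Lemma modulus_ge0 z : 0 <= modulus z.
Proof. by rewrite -ler_ofR -modulusE normr_ge0. Qed.

Lemma modulus_ofR x : modulus (ofR x) = `|x|.
Proof. by apply: ofR_inj; rewrite -modulusE /ofR normc_def/= expr0n addr0 sqrtr_sqr. Qed.

Lemma modulus0 : modulus 0 = 0.
Proof. by apply: ofR_inj; rewrite -modulusE normr0. Qed.

Lemma modulus_eq0 z : (modulus z == 0) = (z == 0).
Proof. by rewrite -(inj_eq ofR_inj) -modulusE normr_eq0. Qed.

Lemma modulusM z w : modulus (z * w) = modulus z * modulus w.
Proof. by apply: ofR_inj; rewrite rmorphM/= -!modulusE normrM. Qed.

Lemma modulusX z n : modulus (z ^+ n) = modulus z ^+ n.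
Proof. by apply: ofR_inj; rewrite rmorphXn/= -!modulusE normrX. Qed.

Lemma modulusV z : modulus z^-1 = (modulus z)^-1.
Proof. by apply: ofR_inj; rewrite fmorphV/= -!modulusE normfV. Qed.

Lemma modulusN z : modulus (- z) = modulus z.
Proof. by apply: ofR_inj; rewrite -!modulusE normrN. Qed.

Lemma ler_modulusD z w : modulus (z + w) <= modulus z + modulus w.
Proof. by rewrite -ler_ofR rmorphD/= -!modulusE ler_normD. Qed.

Lemma ler_modulusB z w : modulus (z - w) <= modulus z + modulus w.
Proof. by rewrite -(modulusN w) ler_modulusD. Qed.

Lemma ler_modulus_sum (I : Type) (r : seq I) (u : I -> C) :
  modulus (\sum_(k <- r) u k) <= \sum_(k <- r) modulus (u k).
Proof.
elim/big_rec2: _ => [|k s z _ zs]; first by rewrite modulus0.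
by rewrite (le_trans (ler_modulusD _ _))// lerD2l.
Qed.

Lemma ler_modulus_ReIm z :
  modulus z <= `|complex.Re z| + `|complex.Im z|.
Proof.
case: z => a b; rewrite /modulus normc_def /=.
rewrite -[leRHS]ger0_norm ?addr_ge0// -sqrtr_sqr ler_wsqrtr//.
rewrite -(real_normK (num_real a)) -(real_normK (num_real b)).
by rewrite sqrrD lerD2r lerDl mulrn_wge0// mulr_ge0.
Qed.

Lemma Re_le_modulus z : `|complex.Re z| <= modulus z.
Proof.
case: z => a b; rewrite /modulus normc_def /= -sqrtr_sqr ler_wsqrtr//.
by rewrite lerDl sqr_ge0.
Qed.

Lemma Im_le_modulus z : `|complex.Im z| <= modulus z.
Proof.
case: z => a b; rewrite /modulus normc_def /= -sqrtr_sqr ler_wsqrtr//.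
by rewrite lerDr sqr_ge0.
Qed.

Lemma cvg_at0 (g : C -> C) (l : C) (B rho : R) : 0 < rho ->
  (forall w, w != 0 -> modulus w <= rho -> modulus (g w - l) <= B * modulus w) ->
  g w @[w --> 0^'] --> l.
Proof.
move=> rho0 gB; apply/cvgrPdist_lt => e e0.
have [r r0 ->] : exists2 r, 0 < r & e = ofR r.
  by case: e e0 => a b; rewrite ltcE/= => /andP[/eqP-> a0]; exists a.
(* [B] may be zero or negative; [|B| + 1] is a positive divisor in every case. *)
pose d := Num.min rho (r / (`|B| + 1)).
have B1 : 0 < `|B| + 1 by rewrite ltr_wpDl.
have d0 : 0 < d by rewrite lt_min rho0 divr_gt0.
near=> w.
have w0 : w != 0 by near: w; exact: (@nbhs_dnbhs_neq C 0).
have yd : modulus w < d.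
  rewrite -ltr_ofR -modulusE; near: w; apply: dnbhs0_lt.
  by rewrite -[0]/(ofR 0) ltr_ofR.
have [yrho yr] : modulus w < rho /\ modulus w * (`|B| + 1) < r.
  by move: yd; rewrite lt_min ltr_pdivlMr// => /andP[].
rewrite modulusE ltr_ofR -modulusN opprB (le_lt_trans (gB _ w0 (ltW yrho)))//.
apply: le_lt_trans yr; rewrite mulrC ler_wpM2l ?modulus_ge0//.
by rewrite (le_trans (ler_norm _))// lerDl.
Unshelve. all: by end_near. Qed.

End real_modulus.

Section power_series_germs.
Context {R : realType}.
Local Notation C := (Cx R).
Implicit Types (x y M K t : R) (z w : C) (f p q : C -> C) (a b d : nat -> R).

(* The lower and upper error bounds form nested intervals. *)
Lemma exists_geometric_sum (u : nat -> R) M t : 0 <= t <= 1 / 2 ->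
  (forall k, `|u k| <= M * t ^+ k) ->
  exists s, forall N, `|s - \sum_(k < N) u k| <= 2 * M * t ^+ N.
Proof.
move=> /andP[t0 t12] uM.
have Mt0 k : 0 <= M * t ^+ k by exact: le_trans (normr_ge0 _) (uM k).
pose S N := \sum_(k < N) u k.
(* As [t <= 1 / 2], the radius [2 * M * t ^+ n] drops at each step by at least [M * t ^+ n], the
   size allowed for [u n]. Hence the intervals nest. *)
have half k : M * t ^+ k.+1 <= M * t ^+ k / 2.
  have := Mt0 k; rewrite exprSr mulrA => h; rewrite ler_wpM2l//; lra.
pose lo n : R := S n - 2 * M * t ^+ n.
pose hi n := S n + 2 * M * t ^+ n.
have loS : nondecreasing_seq lo.
  apply/nondecreasing_seqP => n; rewrite /lo /S big_ord_recr/=.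
  by have /ler_normlP[h1 h2] := uM n; have h3 := half n; lra.
have hiS : nonincreasing_seq hi.
  apply/nonincreasing_seqP => n; rewrite /hi /S big_ord_recr/=.
  by have /ler_normlP[h1 h2] := uM n; have h3 := half n; lra.
have lohi n m : lo n <= hi m.
  apply: (@le_trans _ _ (lo (maxn n m))); first by rewrite loS// leq_maxl.
  apply: (@le_trans _ _ (hi (maxn n m))); last by rewrite hiS// leq_maxr.
  by rewrite /lo /hi; have := Mt0 (maxn n m); lra.
have ubhi m : ubound (range lo) (hi m) by move=> _ [n _ <-].
have suplo : has_sup (range lo) by split; [exists (lo 0%N), 0%N|exists (hi 0%N)].
exists (sup (range lo)) => N; rewrite ler_distl.
apply/andP; split; last exact: (ge_sup (proj1 suplo) (ubhi N)).
by apply: (ub_le_sup (proj2 suplo)); exists N.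
Qed.

Lemma exists_geometric_sum_Cx (u : nat -> C) M t : 0 <= t <= 1 / 2 ->
  (forall k, modulus (u k) <= M * t ^+ k) ->
  exists s, forall N, modulus (s - \sum_(k < N) u k) <= 4 * M * t ^+ N.
Proof.
move=> t12 uM.
have [//|X XE] := @exists_geometric_sum (fun k => complex.Re (u k)) M t t12.
  by move=> k; exact: le_trans (Re_le_modulus _) (uM k).
have [//|Y YE] := @exists_geometric_sum (fun k => complex.Im (u k)) M t t12.
  by move=> k; exact: le_trans (Im_le_modulus _) (uM k).
exists (X +i* Y)%C => N.
have -> : \sum_(k < N) u k =
  ((\sum_(k < N) complex.Re (u k)) +i* (\sum_(k < N) complex.Im (u k)))%C :> C.
  elim: N => [|N IH]; first by rewrite !big_ord0.
  by rewrite !big_ord_recr/= IH; case: (u N).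
apply: (le_trans (ler_modulus_ReIm _)).
by have /= := XE N; have /= := YE N; lra.
Qed.

(* A geometric bound on every remainder replaces convergence of the series, so
   that quotients need no Cauchy products of infinite series. *)
Definition has_power_series f a := exists M K : R, [/\ 0 < M, 1 <= K,
  forall k, `|a k| <= M * K ^+ k &
  forall z N, K * modulus z <= 1 / 2 ->
    modulus (f z - \sum_(k < N) ofR (a k) * z ^+ k) <= M * (K * modulus z) ^+ N].

(** Lets two functions share one pair of constants. *)
Lemma has_power_series_le f a M K : 0 < M -> 1 <= K ->
  (forall k, `|a k| <= M * K ^+ k) ->
  (forall z N, K * modulus z <= 1 / 2 ->
    modulus (f z - \sum_(k < N) ofR (a k) * z ^+ k) <= M * (K * modulus z) ^+ N) ->
  forall M' K', M <= M' -> K <= K' ->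
  (forall k, `|a k| <= M' * K' ^+ k) /\
  (forall z N, K' * modulus z <= 1 / 2 ->
    modulus (f z - \sum_(k < N) ofR (a k) * z ^+ k) <= M' * (K' * modulus z) ^+ N).
Proof.
move=> M0 K1 aM fM M' K' MM' KK'; have K0 : 0 <= K by lra.
split=> [k|z N zK'].
  apply: (le_trans (aM k)); apply: ler_pM => //; [exact/ltW|exact: exprn_ge0|].
  by rewrite lerXn2r// nnegrE// (le_trans K0).
have zKK' : K * modulus z <= K' * modulus z by rewrite ler_wpM2r// modulus_ge0.
have z0 := modulus_ge0 z.
apply: (le_trans (fM _ _ (le_trans zKK' zK'))).
apply: ler_pM => //; [exact/ltW|by rewrite exprn_ge0// mulr_ge0|].
by rewrite lerXn2r// nnegrE mulr_ge0// (le_trans K0).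
Qed.

(** For [z = 0] and [N = 1] the error bound is 0. *)
Lemma has_power_series_at0 f a : has_power_series f a -> f 0 = ofR (a 0%N).
Proof.
move=> [M [K [M0 K1 _ fM]]].
have := fM 0 1%N; rewrite modulus0 mulr0 expr1 mulr0 big_ord1 expr0 mulr1.
rewrite divr_ge0// => /(_ isT) h; apply/eqP; rewrite -subr_eq0 -modulus_eq0.
by rewrite eq_le h modulus_ge0.
Qed.

(** The numerator and the denominator of each Schur step are, up to the factor [z], affine in one
    function. *)
Lemma has_power_series_affine x y f a : has_power_series f a ->
  has_power_series (fun z => ofR x + ofR y * f z)
    (fun k => x *+ (k == 0)%N + y * a k).
Proof.
move=> [M [K [M0 K1 aM fM]]].
have xn n : `|x *+ n| <= `|x| *+ n by rewrite normrMn.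
exists (`|x| + `|y| * M + 1), K; split => //.
- have := normr_ge0 x; have := normr_ge0 y; nra.
- move=> k; rewrite (le_trans (ler_normD _ _))//.
  have K1k : 1 <= K ^+ k by rewrite exprn_ege1.
  have xk : `|x *+ (k == 0)%N| <= `|x|.
    by rewrite (le_trans (xn _))//; case: eqP => // _; rewrite ?mulr1n ?mulr0n.
  rewrite normrM; have := aM k.
  have := normr_ge0 x; have := normr_ge0 y; have := normr_ge0 (a k).
  nra.
- move=> z N zK; pose S := \sum_(k < N) ofR (a k) * z ^+ k.
  have -> : ofR x + ofR y * f z -
      \sum_(k < N) ofR (x *+ (k == 0%N :> nat) + y * a k) * z ^+ k =
      ofR (x *+ (N == 0)%N) + ofR y * (f z - S).
    rewrite mulrBr /S mulr_sumr; case: N {S} => [|N].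
      by rewrite !big_ord0 !subr0 mulr1n.
    rewrite !big_ord_recl/= !mulr1n !expr0 !rmorphD/= !rmorphM/= mulr0n rmorph0.
    under eq_bigr do rewrite add0r rmorphM/= -mulrA.
    ring.
  rewrite (le_trans (ler_modulusD _ _))// modulusM !modulus_ofR.
  have t0 : 0 <= K * modulus z by rewrite mulr_ge0 ?modulus_ge0//; lra.
  have := fM z N zK; rewrite -/S.
  have xk : `|x *+ (N == 0)%N| <= `|x| * (K * modulus z) ^+ N.
    by case: N {S} => [|N]; rewrite ?mulr1n ?expr0 ?mulr1 ?mulr0n ?normr0 ?mulr_ge0// exprn_ge0.
  have : 0 <= (K * modulus z) ^+ N by rewrite exprn_ge0.
  have := normr_ge0 y; nra.
Qed.

(** The convolution identity says that [z * q z] times the series of [b] is the series of [p]. Near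
    0 the values of [q] stay away from 0, and after multiplication by [q z] the error is a finite
    combination of the remainders of [p] and [q]. *)
Lemma has_power_series_div p q a d b : has_power_series p a ->
  has_power_series q d -> a 0%N = 0 -> d 0%N != 0 -> (forall n, `|b n| <= 1) ->
  (forall n, \sum_(j < n.+1) b j * d (n - j)%N = a n.+1) ->
  has_power_series (remove_singularity (fun z => p z / (z * q z))) b.
Proof.
move=> [M1 [K1 [M10 K11 aM pM]]] [M2 [K2 [M20 K21 dM qM]]] a0 d0 b1 bE.
pose M := M1 + M2; pose K := K1 + K2.
have [||{}aM {}pM] := has_power_series_le M10 K11 aM pM (M' := M) (K' := K).
  by rewrite lerDl ltW.
  by rewrite /K; lra.
have [||{}dM {}qM] := has_power_series_le M20 K21 dM qM (M' := M) (K' := K).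
  by rewrite lerDr ltW.
  by rewrite /K; lra.
have M0 : 0 < M by rewrite /M; lra.
have Kge1 : 1 <= K by rewrite /K; lra.
have D0 : 0 < `|d 0%N| by rewrite normr_gt0.
(* In [K'], the summand [2 * K] absorbs a factor [N <= 2 ^+ N], and the other one forces
   [|q z| >= |d 0| / 2]. That lower bound yields the factor [2 / |d 0|] in [M']; the [+ 1] covers
   [|b k| <= 1]. *)
pose M' := 2 * M * (K + 1) / `|d 0%N| + 1.
pose K' := 2 * K + M * K / `|d 0%N| * 2.
have MK0 : 0 < M * K / `|d 0%N| by rewrite divr_gt0// mulr_gt0//; lra.
have K'1 : 1 <= K' by rewrite /K'; lra.
have M'1 : 1 <= M'.
  by rewrite /M' lerDr divr_ge0// mulr_ge0// ?mulr_ge0//; lra.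
pose B N z := \sum_(k < N) ofR (b k) * z ^+ k.
pose P N z := \sum_(k < N) ofR (a k) * z ^+ k.
pose Q N z := \sum_(k < N) ofR (d k) * z ^+ k.
(* Each [b j] meets [q] truncated below degree [N - j], so exactly the products of total degree
   below [N] occur and nothing is left over. *)
have convE N z : \sum_(j < N) ofR (b j) * z ^+ j * Q (N - j)%N z * z = P N.+1 z.
  elim: N => [|N IH]; first by rewrite big_ord0 /P big_ord1 a0 rmorph0 mul0r.
  rewrite /P [RHS]big_ord_recr/= -/(P N.+1 z) -IH -bE rmorph_sum/= mulr_suml.
  rewrite [X in _ = _ + X]big_ord_recr/= subnn.
  rewrite big_ord_recr/= subSnn /Q big_ord1 expr0 mulr1 addrA; congr (_ + _); last first.
    by rewrite rmorphM/= exprSr; ring.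
  rewrite -big_split/=; apply: eq_bigr => j _.
  rewrite subSn; last exact: ltnW.
  rewrite big_ord_recr/= rmorphM/=.
  have -> : z ^+ N.+1 = z ^+ j * z ^+ (N - j) * z.
    by rewrite -exprD subnKC ?exprSr// ltnW.
  by ring.
have main z N : z != 0 -> K' * modulus z <= 1 / 2 ->
    modulus (p z / (z * q z) - B N z) <= M' * (K' * modulus z) ^+ N.
  move=> z0 zK'.
  have r0 : 0 < modulus z by rewrite lt0r modulus_eq0 z0 modulus_ge0.
  set r := modulus z in r0 zK' *.
  have zK : K * r <= 1 / 2.
    apply: le_trans zK'; rewrite ler_wpM2r// ?ltW// /K'; lra.
  have zd : M * K * r <= `|d 0%N| / 2.
    have : M * K / `|d 0%N| * 2 * r <= 1 / 2.
      by apply: le_trans zK'; rewrite ler_wpM2r// ?ltW// /K'; lra.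
    have -> : M * K / `|d 0%N| * 2 * r = 2 * (M * K * r) / `|d 0%N| by ring.
    by rewrite ler_pdivrMr//; lra.
  have qd : `|d 0%N| / 2 <= modulus (q z).
    have := qM z 1%N zK; rewrite big_ord1 expr0 mulr1 expr1 mulrA -/r => h.
    have := ler_modulusB (q z) (q z - ofR (d 0%N)).
    by rewrite subKr modulus_ofR; lra.
  have q0 : q z != 0 by rewrite -modulus_eq0; apply: lt0r_neq0; lra.
  (* By [convE] the partial sums satisfy the exact identity below, and both of its
     terms are of order [z ^+ N]. *)
  have E : q z * (p z / (z * q z) - B N z) = (p z - P N.+1 z) / z -
      \sum_(j < N) ofR (b j) * z ^+ j * (q z - Q (N - j)%N z).
    rewrite -convE.
    under [X in _ = _ - X]eq_bigr do rewrite mulrBr.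
    rewrite sumrB -!mulr_suml -/(B N z).
    by field; rewrite z0 q0.
  have Kr0 : 0 <= K * r by rewrite mulr_ge0// ?ltW//; lra.
  have bound : modulus (q z * (p z / (z * q z) - B N z)) <=
      M * (K + 1) * (2 * K * r) ^+ N.
    rewrite E (le_trans (ler_modulusB _ _))//.
    have h1 : modulus ((p z - P N.+1 z) / z) <= M * K * (K * r) ^+ N.
      rewrite modulusM modulusV -/r ler_pdivrMr// (le_trans (pM z N.+1 zK))//.
      by rewrite -/r exprSr le_eqVlt; apply/orP; left; apply/eqP; ring.
    have h2 : modulus (\sum_(j < N) ofR (b j) * z ^+ j * (q z - Q (N - j)%N z)) <=
        M * N%:R * (K * r) ^+ N.
      rewrite (le_trans (ler_modulus_sum _ _))//.
      rewrite (@le_trans _ _ (\sum_(j < N) M * (K * r) ^+ N))//; last first.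
        by rewrite [leRHS]mulrAC mulr_natr sumr_const card_ord.
      apply: ler_sum => j _; rewrite !modulusM modulus_ofR modulusX -/r.
      have := qM z (N - j)%N zK; rewrite -/r -/(Q _ _) => h.
      have -> : (K * r) ^+ N = (K * r) ^+ j * (K * r) ^+ (N - j).
        by rewrite -exprD subnKC// ltnW.
      rewrite [leRHS]mulrCA; apply: ler_pM => //.
      + by rewrite mulr_ge0// exprn_ge0// ltW.
      + exact: modulus_ge0.
      + rewrite -[leRHS]mul1r; apply: ler_pM => //; first by rewrite exprn_ge0// ltW.
        by rewrite lerXn2r// ?nnegrE ?(ltW r0)// ler_peMl// ltW.
    have N2 : N%:R <= 2 ^+ N :> R by rewrite -natrX ler_nat ltnW// ltn_expl.
    have two1 : 1 <= 2 ^+ N :> R by rewrite exprn_ege1// ler1n.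
    have -> : (2 * K * r) ^+ N = 2 ^+ N * (K * r) ^+ N by rewrite -mulrA exprMn.
    have KrN : 0 <= M * (K * r) ^+ N by rewrite mulr_ge0 ?exprn_ge0// ltW.
    have : M * (K * r) ^+ N * (K + N%:R) <= M * (K * r) ^+ N * ((K + 1) * 2 ^+ N).
      by rewrite ler_wpM2l//; nra.
    by move: h1 h2; lra.
  have qi : 0 < modulus (q z) by lra.
  rewrite modulusM in bound.
  have X0 := modulus_ge0 (p z / (z * q z) - B N z).
  have : `|d 0%N| / 2 * modulus (p z / (z * q z) - B N z) <=
      M * (K + 1) * (2 * K * r) ^+ N.
    by apply: le_trans bound; rewrite ler_wpM2r.
  rewrite mulrAC ler_pdivrMr// mulrC -ler_pdivlMr// => h.
  apply: (le_trans h).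
  have -> : M * (K + 1) * (2 * K * r) ^+ N * 2 / `|d 0%N| = (M' - 1) * (2 * K * r) ^+ N.
    by rewrite /M'; ring.
  apply: ler_pM.
  - lra.
  - by rewrite exprn_ge0// mulr_ge0// ?ltW//; lra.
  - lra.
  - rewrite lerXn2r// ?nnegrE ?mulr_ge0 ?(ltW r0)//; try lra.
    by rewrite ler_wpM2r ?(ltW r0)// /K'; lra.
(* The value at 0 is a limit by definition; [main] with [N = 1] bounds the distance to [b 0]
   linearly. *)
have at0 : remove_singularity (fun z => p z / (z * q z)) 0 = ofR (b 0%N).
  rewrite /remove_singularity eqxx.
  apply: cvg_lim; first exact: norm_hausdorff.
  apply: (@cvg_at0 _ _ _ (M' * K') (1 / 2 / K')).
    by rewrite !divr_gt0//; lra.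
  move=> w w0 wK; have := main w 1%N w0.
  rewrite /B big_ord1 expr0 mulr1 expr1 mulrA; apply.
  by move: wK; rewrite ler_pdivlMr; [rewrite mulrC|lra].
exists M', K'; split => //; first lra.
- by move=> k; rewrite (le_trans (b1 k))// mulr_ege1// exprn_ege1.
- move=> z N zK; have [->|z0] := eqVneq z 0; last first.
    have := main z N z0 zK.
    by rewrite /remove_singularity (negbTE z0).
  rewrite at0 modulus0 mulr0; case: N => [|N].
    by rewrite big_ord0 subr0 modulus_ofR expr0 mulr1 (le_trans (b1 _)).
  rewrite big_ord_recl/= big1 ?addr0 ?expr0 ?mulr1 ?subrr ?modulus0 ?expr0n ?mulr0//.
  by move=> i _; rewrite expr0n mulr0.
Qed.

End power_series_germs.

(** * Termwise differentiation and Taylor coefficients *)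

Section taylor_coefficients.
Context {R : realType}.
Local Notation C := (Cx R).
Implicit Types (x y M K : R) (z h : C) (f : C -> C) (a : nat -> R).

(** Lets [N] tend to infinity in an estimate that involves partial sums. *)
Lemma ler_geometric_error x y B : (forall N, x <= y + B * (1 / 2) ^+ N) -> x <= y.
Proof.
move=> xyB; rewrite leNgt; apply/negP => yx.
have B0 : 0 < B by have := xyB 0%N; rewrite expr0; lra.
have d0 : 0 < (x - y) / B by rewrite divr_gt0// subr_gt0.
have [N _ /(_ N)] := near_infty_natSinv_expn_lt (PosNum d0).
rewrite /= leqnn => /(_ isT) h.
have := xyB N; rewrite leNgt => /negP; apply.
rewrite -ltrBrDl mulrC -ltr_pdivlMr//.
by rewrite expr_div_n expr1n.
Qed.

(** The remainders satisfy [E k.+1 = (z + h) * E k + h ^+ 2 * (k%:R * z ^+ k.-1)], which adds up to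
    a factor below [k ^+ 2]. The [r ^+ 2] on the left avoids a division by [r] and the exponent
    [k - 2]. *)
Lemma ler_modulus_taylor2 z h r k : modulus z <= r -> modulus (z + h) <= r ->
  r ^+ 2 * modulus ((z + h) ^+ k - z ^+ k - h * (k%:R * z ^+ k.-1)) <=
  modulus h ^+ 2 * (k%:R ^+ 2 * r ^+ k).
Proof.
move=> zr zhr; have r0 : 0 <= r := le_trans (modulus_ge0 _) zr.
elim: k => [|k IH].
  by rewrite !expr0 subrr mulr0n expr0n/= !mul0r !mulr0 subrr modulus0 mulr0.
set E := (_ - _ - _) in IH.
have -> : (z + h) ^+ k.+1 - z ^+ k.+1 - h * (k.+1%:R * z ^+ k.+1.-1) =
    (z + h) * E + h ^+ 2 * (k%:R * z ^+ k.-1).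
  rewrite /E /= -(natr1 k) [(z + h) ^+ k.+1]exprS [z ^+ k.+1]exprS.
  case: k {IH E} => [|k]/=; first by rewrite !expr0 mulr0n; ring.
  by rewrite [z ^+ k.+1]exprS; set A := (_ ^+ k.+1); ring.
have h1 : modulus ((z + h) * E) <= r * modulus E.
  by rewrite modulusM ler_wpM2r// modulus_ge0.
have h2 : r * modulus (k%:R * z ^+ k.-1) <= k%:R * r ^+ k.
  rewrite modulusM modulusX -[k%:R](rmorph_nat ofR) modulus_ofR normr_nat.
  case: k {IH E h1} => [|k]/=; first by rewrite !mul0r mulr0.
  rewrite mulrCA exprS; apply: ler_wpM2l => //; apply: ler_wpM2l => //.
  by rewrite lerXn2r// nnegrE modulus_ge0.
apply: (@le_trans _ _ (r ^+ 2 * (r * modulus E +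
    modulus h ^+ 2 * modulus (k%:R * z ^+ k.-1)))).
  rewrite ler_wpM2l ?sqr_ge0// (le_trans (ler_modulusD _ _))// lerD//.
  by rewrite modulusM modulusX.
have h3 : r * (r ^+ 2 * modulus E) <= r * (modulus h ^+ 2 * (k%:R ^+ 2 * r ^+ k)).
  by rewrite ler_wpM2l.
have h4 : modulus h ^+ 2 * r * (r * modulus (k%:R * z ^+ k.-1)) <=
    modulus h ^+ 2 * r * (k%:R * r ^+ k).
  by rewrite ler_wpM2l// mulr_ge0// sqr_ge0.
have h5 : 0 <= modulus h ^+ 2 * (r * (k%:R + 1) * r ^+ k).
  by rewrite !mulr_ge0 ?sqr_ge0 ?exprn_ge0 ?addr_ge0 ?modulus_ge0.
rewrite -natr1 [r ^+ k.+1]exprS.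
lra.
Qed.

(** The differentiated series has a sum [s] by geometric majorization, and the second-order
    remainders of the powers bound the distance from the difference quotient to [s] by a multiple of
    [|h|]. *)
Lemma has_power_series_derive1 f a : has_power_series f a ->
  has_power_series (derive1 f) (fun k => k.+1%:R * a k.+1).
Proof.
move=> [M [K [M0 K1 aM fM]]].
have K0 : 0 < K by lra.
have k2 k : k.+1%:R <= 2 ^+ k :> R by rewrite -natrX ler_nat ltn_expl.
have daM k : `|k.+1%:R * a k.+1| <= M * K * (2 * K) ^+ k.
  rewrite normrM normr_nat exprMn.
  apply: (@le_trans _ _ (2 ^+ k * (M * K ^+ k.+1))).
    by apply: ler_pM => //; rewrite ?aM.
  by rewrite exprS le_eqVlt; apply/orP; left; apply/eqP; ring.
have sum_ex z : 8 * K * modulus z <= 1 / 2 ->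
    exists s, forall N, modulus (s - \sum_(k < N) ofR (k.+1%:R * a k.+1) * z ^+ k) <=
      4 * (M * K) * (2 * K * modulus z) ^+ N.
  move=> zK; have z0 := modulus_ge0 z; apply: (exists_geometric_sum_Cx
    (u := fun k => ofR (k.+1%:R * a k.+1) * z ^+ k)).
    by apply/andP; split; [rewrite !mulr_ge0// ltW|lra].
  move=> k; rewrite modulusM modulusX modulus_ofR exprMn mulrA.
  by rewrite ler_wpM2r// exprn_ge0.
have der z s : 8 * K * modulus z <= 1 / 2 ->
    (forall N, modulus (s - \sum_(k < N) ofR (k.+1%:R * a k.+1) * z ^+ k) <=
      4 * (M * K) * (2 * K * modulus z) ^+ N) ->
    derive1 f z = s.
  move=> zK sE; have z0 := modulus_ge0 z.
  apply: cvg_lim; first exact: norm_hausdorff.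
  (* Then [|z| <= r / 2], which leaves room for [|h| <= r / 2]. In [(K * r) ^+ k = (1 / 2) ^+ k * (1
     / 4) ^+ k] the second factor absorbs [k ^+ 2], and the first has partial sums at most 2. *)
  pose r := (8 * K)^-1.
  have r0 : 0 < r by rewrite invr_gt0 mulr_gt0.
  have Kr : K * r = 1 / 8 by rewrite /r; field; rewrite gt_eqF.
  have zr : modulus z <= r / 2.
    by rewrite /r ler_pdivlMr// -[leRHS]mul1r ler_pdivlMr ?mulr_gt0//; lra.
  apply: (@cvg_at0 _ _ _ (2 * M / r ^+ 2) (r / 2)); first by rewrite divr_gt0.
  move=> h h0 hr.
  have hh0 : 0 < modulus h by rewrite lt0r modulus_eq0 h0 modulus_ge0.
  rewrite -(ler_pM2l hh0) -modulusM.
  have -> : h * (h^-1 *: (f (h + z) - f z) - s) = f (z + h) - f z - h * s.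
    by rewrite -[h^-1 *: _]/(h^-1 * _) mulrBr mulVKf// [h + z]addrC.
  have zhr : modulus (z + h) <= r by rewrite (le_trans (ler_modulusD _ _))//; lra.
  have half_r w N : modulus w <= r ->
      modulus (f w - \sum_(k < N) ofR (a k) * w ^+ k) <= M * (1 / 2) ^+ N.
    move=> wr; have Kw : K * modulus w <= 1 / 8 by rewrite -Kr ler_pM2l.
    rewrite (le_trans (fM w N _))//; first lra.
    rewrite ler_pM2l// lerXn2r// ?nnegrE//; first by rewrite mulr_ge0 ?modulus_ge0// ltW.
    lra.
  (* For fixed [h] the truncation errors of [f] and of [s] die out as [N] grows; the bound [e4] on
     the polynomial part does not depend on [N]. *)
  apply: (@ler_geometric_error _ _ (2 * M + modulus h * (4 * (M * K)))) => N.
  pose T w := \sum_(k < N.+1) ofR (a k) * w ^+ k.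
  pose S := \sum_(k < N) ofR (k.+1%:R * a k.+1) * z ^+ k.
  have -> : f (z + h) - f z - h * s = (f (z + h) - T (z + h)) - (f z - T z)
     - h * (s - S) + (T (z + h) - T z - h * S) by ring.
  have e1 : modulus (f (z + h) - T (z + h)) <= M * (1 / 2) ^+ N.
    rewrite (le_trans (half_r _ _ zhr))// exprS.
    have : 0 <= M * (1 / 2) ^+ N by rewrite mulr_ge0 ?exprn_ge0// ltW.
    lra.
  have e2 : modulus (f z - T z) <= M * (1 / 2) ^+ N.
    rewrite (le_trans (half_r z _ _))//; first lra.
    have : 0 <= M * (1 / 2) ^+ N by rewrite mulr_ge0 ?exprn_ge0// ltW.
    rewrite exprS; lra.
  have e3 : modulus (h * (s - S)) <= modulus h * (4 * (M * K)) * (1 / 2) ^+ N.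
    rewrite modulusM -mulrA ler_pM2l// (le_trans (sE N))//.
    rewrite ler_pM2l ?mulr_gt0// lerXn2r// ?nnegrE//; first by rewrite !mulr_ge0// ltW.
    lra.
  have e4 : modulus (T (z + h) - T z - h * S) <=
      modulus h * (2 * M / r ^+ 2 * modulus h).
    have -> : T (z + h) - T z - h * S = \sum_(k < N.+1) ofR (a k) *
        ((z + h) ^+ k - z ^+ k - h * (k%:R * z ^+ k.-1)).
      under eq_bigr do rewrite !mulrBr.
      rewrite !sumrB -/(T _) -/(T _); congr (_ - _).
      rewrite big_ord_recl/= !mul0r !mulr0 add0r /S mulr_sumr; apply: eq_bigr => k _.
      by rewrite /bump/= add1n rmorphM/= rmorph_nat; ring.
    have -> : modulus h * (2 * M / r ^+ 2 * modulus h) =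
        modulus h ^+ 2 * (2 * M) / r ^+ 2 by ring.
    rewrite ler_pdivlMr ?exprn_gt0// mulrC.
    apply: (@le_trans _ _ (\sum_(k < N.+1) modulus h ^+ 2 * (M * (1 / 2) ^+ k))).
      apply: (@le_trans _ _ (r ^+ 2 * \sum_(k < N.+1) modulus (ofR (a k) *
        ((z + h) ^+ k - z ^+ k - h * (k%:R * z ^+ k.-1))))).
        by rewrite ler_wpM2l ?sqr_ge0// ler_modulus_sum.
      rewrite mulr_sumr; apply: ler_sum => k _.
      have zr' : modulus z <= r by lra.
      have := ler_modulus_taylor2 k zr' zhr.
      set E := modulus _ => E2; rewrite modulusM modulus_ofR -/E.
      have : `|a k| * (r ^+ 2 * E) <=
          M * K ^+ k * (modulus h ^+ 2 * (k%:R ^+ 2 * r ^+ k)).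
        by apply: ler_pM => //; rewrite mulr_ge0 ?sqr_ge0 ?modulus_ge0.
      rewrite mulrCA => /le_trans; apply.
      have -> : M * K ^+ k * (modulus h ^+ 2 * (k%:R ^+ 2 * r ^+ k)) =
          modulus h ^+ 2 * (M * (k%:R ^+ 2 * (K * r) ^+ k)).
        by rewrite exprMn; ring.
      rewrite ler_wpM2l ?sqr_ge0// ler_pM2l// Kr.
      have -> : (1 / 8 : R) ^+ k = (1 / 2) ^+ k * (1 / 4) ^+ k.
        by rewrite -exprMn; congr (_ ^+ _); lra.
      rewrite mulrCA ler_piMr ?exprn_ge0// expr_div_n expr1n.
      rewrite mulrA mulr1 ler_pdivrMr ?exprn_gt0// mul1r.
      have -> : (4 : R) ^+ k = (2 ^+ k) ^+ 2.
        by rewrite exprAC; congr (_ ^+ _); ring.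
      by apply: lerXn2r; rewrite ?nnegrE ?exprn_ge0// (le_trans _ (k2 k))// ler_nat leqnSn.
    rewrite -mulr_sumr ler_wpM2l ?sqr_ge0// -mulr_sumr mulrC ler_pM2r//.
    elim: N {T S e1 e2 e3} => [|n IH]; first by rewrite big_ord1 expr0 ler1n.
    rewrite big_ord_recl expr0.
    under eq_bigr do rewrite lift0 exprS.
    by rewrite -mulr_sumr; lra.
  apply: (le_trans (ler_modulusD _ _)).
  have := ler_modulusB (f (z + h) - T (z + h) - (f z - T z)) (h * (s - S)).
  have := ler_modulusB (f (z + h) - T (z + h)) (f z - T z).
  lra.
exists (4 * (M * K)), (8 * K); split.
- by rewrite !mulr_gt0.
- lra.
- move=> k; apply: (le_trans (daM k)).
  apply: ler_pM; rewrite ?exprn_ge0 ?mulr_ge0 ?(ltW M0) ?(ltW K0)//.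
    have : 0 < M * K by rewrite mulr_gt0.
    lra.
  by rewrite lerXn2r// ?nnegrE ?mulr_ge0 ?(ltW K0)//; lra.
- move=> z N zK; have [s sE] := sum_ex z zK.
  rewrite (der z s zK sE) (le_trans (sE N))//.
  have z0 := modulus_ge0 z; have zK0 := mulr_ge0 (ltW K0) z0.
  rewrite ler_pM2l ?mulr_gt0// lerXn2r// ?nnegrE; lra.
Qed.

Lemma taylor_coefficient_power_series f a n : has_power_series f a ->
  taylor_coefficient f n = ofR (a n).
Proof.
move=> fa; rewrite /taylor_coefficient.
suff -> : derive1n n f 0 = ofR (n`!%:R * a n).
  by rewrite rmorphM/= rmorph_nat mulrAC mulfV ?mul1r// pnatr_eq0 -lt0n fact_gt0.
elim: n f a fa => [|n IH] f a fa; first by rewrite derive1n0 (has_power_series_at0 fa) mul1r.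
rewrite /derive1n iterSr -/(derive1n n _) (IH _ _ (has_power_series_derive1 fa)).
by rewrite factS natrM; congr ofR; ring.
Qed.

End taylor_coefficients.

(** * Integration against muhat *)

Section acos_integrals.
Context {R : realType}.
Implicit Types (x t : R) (h H : R -> R).
Local Notation mu := (@lebesgue_measure R).

(** A decreasing surjection between segments is continuous, including at the endpoints, where [acos]
    is not differentiable. *)
Lemma within_continuous_acos : {within `[-1, 1], continuous (@acos R)}.
Proof.
have itv01 : `[(-1 : R), 1] = `[cos pi, cos 0] by rewrite cospi cos0.
apply: segment_dec_surj_continuous.
  move=> x y; rewrite itv01 => xB yB.
  apply: (@segment_can_ge _ 0 pi cos acos (pi_ge0 R)) => //.
    by apply: continuous_subspaceT => z; exact: continuous_cos.
  exact: cosK.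
move=> t /=; rewrite acos1 acosN1 in_itv/= => /andP[t0 tpi].
exists (cos t); first by rewrite /= in_itv/= cos_geN1 cos_le1.
by rewrite cosK// in_itv/= t0.
Qed.

Lemma within_continuous_comp_acos h : continuous h ->
  {within `[-1, 1], continuous (h \o @acos R)}.
Proof.
by move=> ch; apply: within_continuous_comp => //; exact: within_continuous_acos.
Qed.

(** This is the substitution [x = cos t]: in the derivative of [H \o acos], the factor
    [sin (acos x)] cancels the square root from the derivative of [acos]. At the endpoints
    continuity suffices. *)
Lemma integral_comp_acos h H : continuous h ->
  (forall t, is_derive t 1 H (- (h t * sin t))) ->
  (\int[mu]_(x in `[(-1)%R, 1%R]) (h (acos x))%:E = (H 0 - H pi)%:E)%E.
Proof.
move=> ch dH.
have cH : continuous H.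
  by move=> t; apply: differentiable_continuous; apply/derivable1_diffP; exact: ex_derive.
have dF x : -1 < x < 1 -> is_derive x 1 (H \o @acos R) (h (acos x)).
  move=> x11; have x11' : -1 <= x <= 1 by case/andP: x11 => a b; rewrite !ltW.
  have s0 : Num.sqrt (1 - x ^+ 2) != 0.
    by rewrite sqrtr_eq0 -ltNge; case/andP: x11; nra.
  have da := is_derive1_acos x11; have dHa := dH (acos x).
  apply: is_derive_eq.
  by rewrite /GRing.scale/= sin_acos//; field.
rewrite (@continuous_FTC2 _ (h \o @acos R) (H \o @acos R)) //.
- by rewrite /= acos1 acosN1 EFinB.
- exact: within_continuous_comp_acos.
- have ltN11 : (-1 : R) < 1 by lra.
  have /(continuous_within_itvP _ ltN11)[] := within_continuous_comp_acos cH.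
  move=> _ ? ?; split => // x; rewrite in_itv/= => /dF h1; exact: ex_derive.
- by move=> x; rewrite in_itv/= => /dF h1; rewrite derive1E derive_val.
Qed.

(** Replacing [x] by [- x] turns [acos x] into [pi - acos x], so the integral is finite and equal to
    its opposite. *)
Lemma integral_comp_acos_odd h : continuous h ->
  (forall t, h (pi - t) = - h t) ->
  (\int[mu]_(x in `[(-1)%R, 1%R]) (h (acos x))%:E = 0)%E.
Proof.
move=> ch hodd.
have ch' := within_continuous_comp_acos ch.
have h1 := @integration_by_substitution_oppr R (h \o @acos R) (-1) 1.
rewrite opprK in h1.
have {}h1 := h1 _ ch'.
have le11 : (-1 : R) <= 1 by lra.
have ih : mu.-integrable `[-1, 1] (EFin \o (h \o @acos R)).
  by apply: continuous_compact_integrable => //; exact: segment_compact.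
have h2 : (\int[mu]_(x in `[(-1)%R, 1%R]) (h (acos x))%:E =
    - \int[mu]_(x in `[(-1)%R, 1%R]) (h (acos x))%:E)%E.
  rewrite [LHS](h1 le11) -integralN.
    apply: eq_integral => x; rewrite inE/= in_itv/= => x11.
    by rewrite acosN// hodd EFinN.
  exact: integrable_add_def ih.
have : (\int[mu]_(x in `[(-1)%R, 1%R]) (h (acos x))%:E)%E \is a fin_num.
  exact: integrable_fin_num ih.
move: h2; case: (integral _ _ _) => [r| |] // [] /eqP.
by rewrite -subr_eq0 opprK -mulr2n mulrn_eq0/= => /eqP->.
Qed.

Lemma asinE_acos x : -1 <= x <= 1 -> asin x = pi / 2 - acos x.
Proof.
move=> x11.
have a0 := acos_ge0 x11; have api := acos_lepi x11.
rewrite -[x in LHS](acosK (x := x)) ?in_itv//.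
have -> : cos (acos x) = sin (pi / 2 - acos x).
  by rewrite sinB cos_pihalf sin_pihalf mul0r subr0 mul1r.
by rewrite sinK// in_itv/=; apply/andP; split; lra.
Qed.

End acos_integrals.

Section muhat_integrals.
Context {R : realType}.
Implicit Types (x B : R) (u v : R -> R).
Local Notation mu := (@lebesgue_measure R).
Local Notation I := (`[(-1 : R), 1]%classic : set (measurableTypeR R)).

(** For [x >= 1 / 2] the bound [asin x <= pi / 2] is enough; below, the mean value theorem applies
    with a derivative at most [2 <= pi]. *)
Lemma asin_le x : 0 < x <= 1 -> asin x <= pi * x.
Proof.
move=> /andP[x0 x1]; have p2 := pi_ge2 R.
have [xh|xh] := leP (1 / 2) x.
  have : asin x <= pi / 2 by rewrite asin_lepi2// x1 andbT; lra.
  move/le_trans; apply; rewrite ler_pM2l; lra.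
have d y : y \in `]0, x[ -> is_derive y 1 (@asin R) (Num.sqrt (1 - y ^+ 2))^-1.
  by rewrite in_itv/= => /andP[y0 yx]; apply: is_derive1_asin; apply/andP; split; lra.
have c : {within `[0, x], continuous (@asin R)}.
  apply: derivable_within_continuous => y; rewrite in_itv/= => /andP[y0 yx].
  have y11 : -1 < y < 1 by apply/andP; split; lra.
  by have h := is_derive1_asin y11; exact: ex_derive.
have [y] := MVT x0 d c; rewrite in_itv/= => /andP[y0 yx].
have asin0 : asin (0 : R) = 0.
  rewrite -[in LHS](sin0 R) sinK// in_itv/= oppr_le0 andbb divr_ge0//; lra.
rewrite asin0 !subr0 => ->; apply: ler_wpM2r; first exact: ltW.
apply: le_trans p2.
have s1 : 1 / 2 <= Num.sqrt (1 - y ^+ 2).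
  rewrite -[leLHS]ger0_norm; last lra.
  by rewrite -sqrtr_sqr ler_wsqrtr//; nra.
have s0 : 0 < Num.sqrt (1 - y ^+ 2) by lra.
by rewrite -[leLHS]mul1r ler_pdivrMr//; lra.
Qed.

(** Gives the finiteness of [muhat] before its total mass is known. Evenness reduces the bound to
    [x > 0]. *)
Lemma muhat_density_le x : -1 <= x <= 1 -> muhat_density x <= (ln 2)^-1.
Proof.
move=> x11; have p0 := pi_gt0 R; have l0 : 0 < ln (2 : R) by rewrite ln_gt0// ltr1n.
suff q : asin x / x <= pi.
  rewrite /muhat_density invfM mulrAC mulrC; apply: ler_piMr.
    by rewrite invr_ge0 ltW.
  by rewrite mulrC ler_pdivrMr// mul1r.
have [->|x0] := eqVneq x 0; first by rewrite invr0 mulr0 ltW.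
have pos (y : R) : 0 < y <= 1 -> asin y / y <= pi.
  by move=> y01; rewrite ler_pdivrMr; [exact: asin_le|case/andP: y01].
have [xp|xn] := ltP 0 x; first by apply: pos; rewrite xp; case/andP: x11.
have {x0}xn : x < 0 by rewrite lt_neqAle x0.
have := pos (- x); rewrite invrN mulrN asinE_acos; last first.
  by case/andP: x11 => *; apply/andP; split; lra.
rewrite acosN// asinE_acos// -mulNr => h.
have -> : (pi / 2 - acos x) / x = - (pi / 2 - (pi - acos x)) / x by congr (_ / _); lra.
by apply: h; case/andP: x11 => *; apply/andP; split; lra.
Qed.

Lemma muhat_fin_num_fun : fin_num_fun (@muhat R).
Proof.
move=> A mA; rewrite ge0_fin_numE//.
have h : (muhat A <= \int[mu]_(x in A `&` I) ((ln (2 : R))^-1)%:E)%E.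
  rewrite /muhat; apply: ge0_le_integral => //=.
  - exact: measurableI.
  - by move=> x [_]; rewrite /= in_itv/= lee_fin => /muhat_density_ge0.
  - apply/measurable_EFinP; apply: measurable_funS (measurable_itv _) _ _; last first.
      exact: measurable_muhat_density.
    by move=> x [].
  - by move=> x [_]; rewrite /= in_itv/= lee_fin => /muhat_density_le.
apply: (le_lt_trans h).
rewrite integral_cst//=; last exact: measurableI.
rewrite lte_mul_pinfty// ?lee_fin ?invr_ge0 ?ln_ge0 ?ler1n//.
apply: (@le_lt_trans _ _ (mu I)); first by rewrite measureIr.
by rewrite lebesgue_measure_itv/=; case: ifP => _; rewrite ?ltry// -EFinB ltry.
Qed.

HB.instance Definition _ := Measure_isFinite.Build _ _ _ (@muhat R) muhat_fin_num_fun.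

Let pdf : R -> R := (@muhat_density R) \_ I.

Let measurable_pdf : measurable_fun setT pdf.
Proof.
by apply/(measurable_restrictT _ _).1 => //; exact: (@measurable_muhat_density R).
Qed.

Let muhatE A : measurable A -> muhat A = (\int[mu]_(x in A) (pdf x)%:E)%E.
Proof.
move=> mA; rewrite /muhat integral_mkcondr; apply: eq_integral => x _.
by rewrite /pdf restrict_EFin.
Qed.

Let muhat_dominates : @muhat R `<< mu.
Proof.
apply/null_content_dominatesP => A mA A0; rewrite muhatE//.
apply: null_set_integral => //.
by apply/measurable_EFinP; exact: measurable_funTS.
Qed.

(** The Radon-Nikodym derivative of [muhat] and the density extended by 0 have the same integral
    over every measurable set, so they agree almost everywhere. *)
Lemma integral_muhat (f : R -> \bar R) : (@muhat R).-integrable setT f ->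
  (\int[muhat]_x f x = \int[mu]_(x in I) (f x * (muhat_density x)%:E))%E.
Proof.
move=> intf.
have mf : measurable_fun setT f by exact: measurable_int intf.
transitivity (\int[mu]_x (f x * (pdf x)%:E))%E; last first.
  rewrite [RHS]integral_mkcond; apply: eq_integral => x _.
  by rewrite /pdf !patchE; case: ifP; rewrite ?mule0.
rewrite -(Radon_Nikodym_change_of_variables muhat_dominates)//.
have iRN := @Radon_Nikodym_integrable _ _ R (charge_of_finite_measure (@muhat R))
  mu muhat_dominates.
apply: ae_eq_integral => //.
- by apply: emeasurable_funM => //; exact: measurable_int iRN.
- by apply: emeasurable_funM => //; exact/measurable_EFinP.
- apply: ae_eqe_mul2l.
  apply: integral_ae_eq => //.
  + exact/measurable_EFinP.
  + by move=> E _ mE; rewrite -Radon_Nikodym_integral//=; exact: muhatE.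
Qed.

Lemma integrable_muhat u B : measurable_fun setT u -> (forall x, `|u x| <= B) ->
  (@muhat R).-integrable setT (EFin \o u).
Proof.
move=> mf uB; apply: measurable_bounded_integrable => //.
  by rewrite -ge0_fin_numE//; exact: muhat_fin_num_fun.
by exists B; split; rewrite ?num_real// => M BM x _ /=; rewrite (le_trans (uB x))// ltW.
Qed.

End muhat_integrals.

(** * Half-harmonic sums and the logarithm of 2 *)

Section half_harmonic.
Context {R : realType}.

(* By [half_harmonicS] this is also the alternating sum of the (-1)^k / (k+1) for
   k < 2N. *)
Definition half_harmonic (N : nat) : R := \sum_(i < N) (N + i).+1%:R^-1.

(** The reciprocals of [2N + 1] and [2N + 2] enter, and that of [N + 1], which is twice the latter,
    leaves. *)
Lemma half_harmonicS N : half_harmonic N.+1 =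
  half_harmonic N + (2 * N%:R + 1)^-1 - (2 * N%:R + 2)^-1.
Proof.
have e : half_harmonic N.+1 + N.+1%:R^-1 = half_harmonic N +
    (2 * N%:R + 1)^-1 + (2 * N%:R + 2)^-1.
  rewrite /half_harmonic.
  have -> : (2 * N%:R + 1)^-1 = (N + N).+1%:R^-1 :> R.
    by rewrite -(natr1 (N + N)) natrD; congr (_^-1); ring.
  have -> : (2 * N%:R + 2)^-1 = (N + N.+1).+1%:R^-1 :> R.
    by rewrite -(natr1 (N + N.+1)) natrD -(natr1 N); congr (_^-1); ring.
  rewrite -(big_ord_recr N (fun i => (N + i).+1%:R^-1))/=.
  rewrite -(big_ord_recr N.+1 (fun i => (N + i).+1%:R^-1))/=.
  rewrite [RHS]big_ord_recl/= addn0 addrC; congr (_ + _).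
  by apply: eq_bigr => i _; rewrite /bump/= add1n addnS.
have -> : half_harmonic N.+1 = half_harmonic N +
    (2 * N%:R + 1)^-1 + (2 * N%:R + 2)^-1 - N.+1%:R^-1 by rewrite -e addrK.
rewrite -(natr1 N); have N0 : 0 <= N%:R :> R by [].
by field; rewrite !gt_eqF//; lra.
Qed.

(** Each reciprocal lies between the increments of [ln] over the two adjacent unit intervals. The
    telescoped upper bound is exactly [ln 2]; the lower one falls short of it by at most
    [harmonic n]. *)
Lemma cvg_half_harmonic : half_harmonic @ \oo --> ln 2.
Proof.
have ln_sub x y : 0 < x -> 0 < y -> ln x - ln y = ln (x / y) :> R.
  by move=> x0 y0; rewrite ln_div.
have up k : k.+2%:R^-1 <= ln k.+2%:R - ln k.+1%:R :> R.
  rewrite -[leRHS]opprK opprB ln_sub//.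
  have -> : k.+1%:R / k.+2%:R = 1 + (- k.+2%:R^-1) :> R.
    have : 0 < k.+1%:R :> R by []; rewrite -(natr1 k.+1).
    by set a := k.+1%:R => a0; field; rewrite gt_eqF//; lra.
  rewrite lerNr le_ln1Dx// ltrN2 invf_lt1// ltr1n//.
have lo k : ln k.+2%:R - ln k.+1%:R <= k.+1%:R^-1 :> R.
  rewrite ln_sub//.
  have -> : k.+2%:R / k.+1%:R = 1 + k.+1%:R^-1 :> R.
    have : 0 < k.+1%:R :> R by []; rewrite -(natr1 k.+1).
    by set a := k.+1%:R => a0; field; rewrite gt_eqF//; lra.
  by rewrite le_ln1Dx// (lt_le_trans _ (_ : 0 <= _))// ltrN10.
have tel n m : \sum_(i < n) (ln (m + i).+2%:R - ln (m + i).+1%:R) =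
    ln (m + n).+1%:R - ln m.+1%:R :> R.
  elim: n => [|n IH]; first by rewrite big_ord0 addn0 subrr.
  by rewrite big_ord_recr/= IH addnS addrC addrA subrK.
rewrite -cvg_shiftS /=.
apply: (@squeeze_cvgr _ _ _ _ (fun n => ln 2 - harmonic n) (fun=> ln 2)).
- near=> n; apply/andP; split.
  + have : \sum_(i < n.+1) (ln (n.+1 + i).+2%:R - ln (n.+1 + i).+1%:R) <=
        half_harmonic n.+1.
      by apply: ler_sum => i _; exact: lo.
    rewrite tel; apply: le_trans.
    have l2 : ln (n.+1 + n.+1).+2%:R = ln 2 + ln n.+2%:R :> R.
      rewrite -lnM ?posrE// -natrM; congr (ln _%:R).
      by rewrite mul2n -addnn !addSn !addnS.
    have h3 := lo (n.+1 + n.+1)%N; rewrite l2 in h3.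
    have h4 : (n.+1 + n.+1).+1%:R^-1 <= n.+1%:R^-1 :> R.
      by rewrite lef_pV2 ?posrE// ler_nat; apply/leqW/leq_addr.
    rewrite /harmonic/=; move: (le_trans h3 h4).
    move: (ln n.+2%:R) (ln (_ + _).+1%:R) (n.+1%:R^-1) => A B c; lra.
  + have : half_harmonic n.+1 <=
        \sum_(i < n.+1) (ln (n + i).+2%:R - ln (n + i).+1%:R).
      by apply: ler_sum => i _; exact: up.
    rewrite tel => /le_trans; apply.
    rewrite addnS ln_sub//.
    have -> : (n + n).+2%:R / n.+1%:R = 2 :> R.
      apply: (mulIf (x := n.+1%:R)); first by rewrite pnatr_eq0.
      by rewrite divfK ?pnatr_eq0// -natrM mul2n -addnn !addSn !addnS.
    by [].
- rewrite -[X in _ --> X]subr0; apply: cvgB; [exact: cvg_cst|exact: cvg_harmonic].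
- exact: cvg_cst.
Unshelve. all: by end_near. Qed.

End half_harmonic.

(** * Trigonometric moments *)

Section borel_complex.
Context {R : realType}.
Local Notation C := (Cx R).

Lemma continuous_Re : continuous (fun z : C => complex.Re z).
Proof.
move=> z; apply/(@cvgrPdist_lt _ _ _ (nbhs (z : C)) (nbhs_filter (z : C))) => e e0.
near=> w; have : modulus (z - w) < e.
  rewrite -ltr_ofR -modulusE; near: w.
  apply/(@nbhs_ballP C C z); exists (ofR e) => //=.
  by rewrite -[0]/(ofR 0) ltr_ofR.
by apply: le_lt_trans; rewrite -raddfB/= Re_le_modulus.
Unshelve. all: by end_near. Qed.

Lemma continuous_Im : continuous (fun z : C => complex.Im z).
Proof.
move=> z; apply/(@cvgrPdist_lt _ _ _ (nbhs (z : C)) (nbhs_filter (z : C))) => e e0.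
near=> w; have : modulus (z - w) < e.
  rewrite -ltr_ofR -modulusE; near: w.
  apply/(@nbhs_ballP C C z); exists (ofR e) => //=.
  by rewrite -[0]/(ofR 0) ltr_ofR.
by apply: le_lt_trans; rewrite -raddfB/= Im_le_modulus.
Unshelve. all: by end_near. Qed.

(** Preimages of open intervals are open in [D], and open sets generate the sigma-algebra. The
    domain [D] makes room for kernels with a pole. *)
Lemma open_continuous_measurable_Cx (D : set C) (h : C -> R) :
  open D -> {in D, continuous h} ->
  measurable_fun (D : set (BorelCx R)) (h : BorelCx R -> R).
Proof.
move=> oD ch; apply: (measurability _ (RGenOpens.measurableE R)).
move=> _ [_ [a [b ->] <-]]; apply: sub_sigma_algebra => /=.
rewrite openE => z [Dz hz]; apply: filterI; first exact: open_nbhs_nbhs.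
by apply: (ch z (mem_set Dz)); apply: open_nbhs_nbhs; split => //; exact: interval_open.
Qed.

Lemma continuous_exprCx n : continuous (fun z : C => z ^+ n).
Proof.
elim: n => [|n IH] z; first exact: cst_continuous.
have -> : (fun w : C => w ^+ n.+1) = (fun w => w * w ^+ n).
  by apply/funext => w; rewrite exprS.
exact: (@cvgM C C (nbhs z) (nbhs_filter (z : C)) _ _ _ _ (@cvg_id _ (nbhs z)) (IH z)).
Qed.

End borel_complex.

Section trigonometric_derivatives.
Context {R : realType}.
Implicit Types a t : R.

Lemma is_derive_mull a t : is_derive t 1 (fun t => a * t) a.
Proof.
have h : is_derive t 1 (a \*: (@id R)) (a *: 1) by exact: is_deriveZ.
by apply: is_derive_eq h _; rewrite /GRing.scale/= mulr1.
Qed.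

Lemma is_derive_cosM a t : is_derive t 1 (fun t => cos (a * t)) (- (a * sin (a * t))).
Proof.
have h1 := is_derive_cos (a * t); have h2 := is_derive_mull a t.
have h := @is_derive1_comp R (@cos R) (fun t => a * t) t _ _ h1 h2.
by apply: is_derive_eq h _; rewrite /GRing.scale/= mulNr mulrC.
Qed.

Lemma is_derive_sinM a t : is_derive t 1 (fun t => sin (a * t)) (a * cos (a * t)).
Proof.
have h1 := is_derive_sin (a * t); have h2 := is_derive_mull a t.
have h := @is_derive1_comp R (@sin R) (fun t => a * t) t _ _ h1 h2.
by apply: is_derive_eq h _; rewrite /GRing.scale/= mulrC.
Qed.

End trigonometric_derivatives.

Section moments.
Context {R : realType}.
Implicit Types (x t : R) (k n : nat).
Local Notation C := (Cx R).
Local Notation mu := (@lebesgue_measure R).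

(** The argument of the point [circle_lift x]. *)
Definition angle x : R := 2 * acos x.

Lemma circle_liftX x n : (circle_lift x : C) ^+ n =
  (cos (n%:R * angle x) +i* sin (n%:R * angle x))%C.
Proof.
elim: n => [|n IH]; first by rewrite mulr0n mul0r cos0 sin0.
rewrite exprS IH /circle_lift -/(angle x) -(natr1 n) mulrDl mul1r cosD sinD.
by apply/eqP; rewrite eq_complex /= [X in _ && X]eq_sym; apply/andP; split;
  apply/eqP; ring.
Qed.

Lemma measurable_circle_lift_comp (D : set C) (h : C -> R) : open D ->
  {in D, continuous h} -> (forall x, D (circle_lift x)) ->
  measurable_fun setT (fun x => h (circle_lift x)).
Proof.
move=> oD ch DW.
apply: (@measurable_comp _ _ _ _ _ _ (D : set (BorelCx R)) h setT circle_lift).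
- by apply: sub_sigma_algebra.
- by move=> _ [x _ <-]; exact: DW.
- exact: open_continuous_measurable_Cx.
- exact: measurable_circle_lift.
Qed.

Lemma measurable_cos_angle n : measurable_fun setT (fun x => cos (n%:R * angle x)).
Proof.
rewrite (_ : (fun x => _) = (fun x => complex.Re ((circle_lift x : C) ^+ n))).
  apply: (@measurable_circle_lift_comp setT (fun z => complex.Re (z ^+ n))) => //.
    exact: openT.
  move=> z _; apply: (@continuous_comp C C R (fun z => z ^+ n)).
    exact: continuous_exprCx.
  exact: continuous_Re.
by apply/funext => x; rewrite circle_liftX.
Qed.

Lemma measurable_sin_angle n : measurable_fun setT (fun x => sin (n%:R * angle x)).
Proof.
rewrite (_ : (fun x => _) = (fun x => complex.Im ((circle_lift x : C) ^+ n))).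
  apply: (@measurable_circle_lift_comp setT (fun z => complex.Im (z ^+ n))) => //.
    exact: openT.
  move=> z _; apply: (@continuous_comp C C R (fun z => z ^+ n)).
    exact: continuous_exprCx.
  exact: continuous_Im.
by apply/funext => x; rewrite circle_liftX.
Qed.

Lemma norm_cos_le1 t : `|cos t| <= 1.
Proof. by rewrite ler_norml cos_geN1 cos_le1. Qed.

Lemma norm_sin_le1 t : `|sin t| <= 1.
Proof. by rewrite ler_norml sin_geN1 sin_le1. Qed.

Lemma integrable_cos_angle n :
  (@muhat R).-integrable setT (EFin \o (fun x => cos (n%:R * angle x))).
Proof.
apply: (integrable_muhat (B := 1)); first exact: measurable_cos_angle.
by move=> x; exact: norm_cos_le1.
Qed.

Lemma integrable_sin_angle n :
  (@muhat R).-integrable setT (EFin \o (fun x => sin (n%:R * angle x))).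
Proof.
apply: (integrable_muhat (B := 1)); first exact: measurable_sin_angle.
by move=> x; exact: norm_sin_le1.
Qed.

Definition cos_moment n : R := \int[@muhat R]_x cos (n%:R * angle x).
Definition sin_moment n : R := \int[@muhat R]_x sin (n%:R * angle x).

(** The factor [x] of [u] cancels the [1 / x] of the density, and [asin x = pi / 2 - acos x] leaves
    a function of [acos x] alone. *)
Lemma integral_muhat_mul_acos (h : R -> R) (u : R -> R) :
  (@muhat R).-integrable setT (EFin \o u) -> continuous h ->
  (forall x, -1 <= x <= 1 -> u x = x * h (acos x)) ->
  (\int[muhat]_x (u x)%:E = ((pi * ln 2)^-1)%:E *
    \int[mu]_(x in `[(-1)%R, 1%R]) (h (acos x) * (pi / 2 - acos x))%:E)%E.
Proof.
move=> iu ch uE; rewrite integral_muhat//.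
have cg : continuous (fun t => h t * (pi / 2 - t)).
  move=> t; apply: cvgM; first exact: ch.
  by apply: cvgB; [exact: cvg_cst|exact: cvg_id].
rewrite -integralZl//; last first.
  apply: (@continuous_compact_integrable _ ((fun t => h t * (pi / 2 - t)) \o acos)).
    exact: segment_compact.
  exact: within_continuous_comp_acos.
apply: eq_integral => x; rewrite inE/= in_itv/= => x11.
rewrite -!EFinM uE// /muhat_density asinE_acos//; congr EFin.
have p0 : pi != 0 :> R by rewrite gt_eqF// pi_gt0.
have l0 : ln 2 != 0 :> R by rewrite gt_eqF// ln_gt0// ltr1n.
(* Nothing cancels at [x = 0], but both sides vanish there, the right one because
   [acos 0 = pi / 2]. *)
have [->|x0] := eqVneq (x : R) 0; last first.
  by move: (@pi R) p0 => p p0; field; rewrite x0 p0 l0.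
by rewrite acos0 subrr !(mul0r, mulr0).
Qed.

Lemma angleM_acos n x : n%:R * angle x = (2 * n%:R) * acos x.
Proof. by rewrite /angle mulrCA mulrA. Qed.

Lemma pi2n n : (pi *+ 2) *+ n = 2 * n%:R * pi :> R.
Proof. by rewrite -mulrnA -natrM mulr_natl. Qed.

(* For [n = 0] the term [n%:R^-1] is 0, which gives the correct value. *)
Lemma cos_momentS n : cos_moment n + cos_moment n.+1 =
  (2 * ln 2)^-1 * (n.+1%:R^-1 - n%:R^-1).
Proof.
have ln2 : 0 < ln (2 : R) by rewrite ln_gt0// ltr1n.
rewrite /cos_moment -RintegralD//; [|exact: integrable_cos_angle..].
(* The two cosines add up to [2 * cos ((2 * n + 1) * t) * cos t], where [cos t = x]. *)
pose h t : R := 2 * cos ((2 * n%:R + 1) * t).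
have ch : continuous h.
  move=> t; apply: cvgM; first exact: cvg_cst.
  apply: continuous_comp; last exact: continuous_cos.
  by apply: cvgM; [exact: cvg_cst|exact: cvg_id].
rewrite /Rintegral (@integral_muhat_mul_acos h) //; last 2 first.
- exact: (integrableD measurableT (integrable_cos_angle n) (integrable_cos_angle n.+1)).
- move=> x x11; rewrite !angleM_acos /h -(natr1 n).
  set t := acos x.
  have -> : 2 * n%:R * t = (2 * n%:R + 1) * t - t by ring.
  have -> : 2 * (n%:R + 1) * t = (2 * n%:R + 1) * t + t by ring.
  by rewrite cosB cosD acosK ?in_itv//; ring.
(* Antiderivatives of [- sin (2 * m * t)] and of [Cm m]. Both are identically 0 for [m = 0], as the
   inverse of 0 is 0; this agrees with [sin 0 = 0]. *)
pose Cm m t : R := (2 * m%:R)^-1 * cos (2 * m%:R * t).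
pose Sm m t : R := (2 * m%:R)^-1 ^+ 2 * sin (2 * m%:R * t).
have dC m t : is_derive t 1 (Cm m) (- sin (2 * m%:R * t)).
  have h1 := is_deriveZ (2 * m%:R : R)^-1 (is_derive_cosM (2 * m%:R) t).
  apply: is_derive_eq h1 _; rewrite /GRing.scale/=.
  have [->|m0] := eqVneq m 0%N; first by rewrite mulr0n !(mulr0, mul0r) sin0 oppr0 mulr0.
  have m0' : m%:R != 0 :> R by rewrite pnatr_eq0.
  by move: (m%:R) m0' => r r0; field.
have dS m t : is_derive t 1 (Sm m) (Cm m t).
  have h1 := is_deriveZ ((2 * m%:R : R)^-1 ^+ 2) (is_derive_sinM (2 * m%:R) t).
  apply: is_derive_eq h1 _; rewrite /GRing.scale/= /Cm.
  have [->|m0] := eqVneq m 0%N; first by rewrite mulr0n !(mulr0, mul0r, invr0).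
  have m0' : m%:R != 0 :> R by rewrite pnatr_eq0.
  by move: (m%:R) m0' => r r0; field.
(* Integration by parts, from [h t * sin t = sin (2 * (n + 1) * t) - sin (2 * n * t)]; the factor
   [pi / 2 - t] is the one differentiated. *)
pose H t := (Cm n.+1 t - Cm n t) * (pi / 2 - t) + (Sm n.+1 t - Sm n t).
have dH t : is_derive t 1 H (- (h t * (pi / 2 - t) * sin t)).
  have d1 := is_deriveB (dC n.+1 t) (dC n t).
  have d2 : is_derive t 1 (cst (pi / 2) - id) (0 - 1).
    exact: is_deriveB.
  have d3 := is_deriveB (dS n.+1 t) (dS n t).
  apply: is_derive_eq (is_deriveD (is_deriveM d1 d2) d3) _.
  rewrite /GRing.scale/= !fctE/h -(natr1 n).
  have -> : 2 * n%:R * t = (2 * n%:R + 1) * t - t by ring.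
  have -> : 2 * (n%:R + 1) * t = (2 * n%:R + 1) * t + t by ring.
  by rewrite sinB sinD; ring.
rewrite (@integral_comp_acos _ (fun t => h t * (pi / 2 - t)) H) //; last first.
  move=> t; apply: cvgM; first exact: ch.
  by apply: cvgB; [exact: cvg_cst|exact: cvg_id].
have cos_pi m : cos (2 * m%:R * pi) = 1 :> R.
  rewrite -pi2n -[_ *+ m]add0r.
  by rewrite (periodicn (@cosD2pi R)) cos0.
have sin_pi m : sin (2 * m%:R * pi) = 0 :> R.
  rewrite -pi2n -[_ *+ m]add0r.
  by rewrite (periodicn (@sinD2pi R)) sin0.
rewrite /H /Cm /Sm !cos_pi !sin_pi !mulr0 cos0 sin0 -EFinM/=.
have p0 : pi != 0 :> R by rewrite gt_eqF// pi_gt0.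
have l0 : ln 2 != 0 :> R by rewrite gt_eqF.
rewrite !invfM; move: (n.+1%:R^-1) (n%:R^-1) (@pi R) p0 => a b p p0.
by field; rewrite l0 p0.
Qed.

(** Expresses the symmetry of sigma under conjugation. Consecutive moments are paired to remove the
    [1 / x]; the resulting integrand changes sign under [t -> pi - t]. *)
Lemma sin_moment_eq0 n : sin_moment n = 0.
Proof.
elim: n => [|n IH].
  by rewrite /sin_moment; under eq_Rintegral do rewrite mul0r sin0;
    rewrite Rintegral_cst// mul0r.
have : sin_moment n + sin_moment n.+1 = 0; last by rewrite IH add0r.
rewrite /sin_moment -RintegralD//; [|exact: integrable_sin_angle..].
pose h t : R := 2 * sin ((2 * n%:R + 1) * t).
have ch : continuous h.
  move=> t; apply: cvgM; first exact: cvg_cst.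
  apply: continuous_comp; last exact: continuous_sin.
  by apply: cvgM; [exact: cvg_cst|exact: cvg_id].
rewrite /Rintegral (@integral_muhat_mul_acos h) //; last 2 first.
- exact: (integrableD measurableT (integrable_sin_angle n) (integrable_sin_angle n.+1)).
- move=> x x11; rewrite !angleM_acos /h -(natr1 n).
  set t := acos x.
  have -> : 2 * n%:R * t = (2 * n%:R + 1) * t - t by ring.
  have -> : 2 * (n%:R + 1) * t = (2 * n%:R + 1) * t + t by ring.
  by rewrite sinB sinD acosK ?in_itv//; ring.
rewrite (@integral_comp_acos_odd _ (fun t => h t * (pi / 2 - t))) ?mule0//.
- move=> t; apply: cvgM; first exact: ch.
  by apply: cvgB; [exact: cvg_cst|exact: cvg_id].
- move=> t; rewrite /h.
  have -> : (2 * n%:R + 1) * (pi - t) = pi - (2 * n%:R + 1) * t + (pi *+ 2) *+ n.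
    by rewrite pi2n; move: (@pi R) => p; ring.
  rewrite (periodicn (@sinD2pi R)).
  by rewrite sinB sinpi cospi; move: (@pi R) => p; field.
Qed.

End moments.

(** * Limits, signs and sum of the cosine moments *)

Section moment_signs.
Context {R : realType}.
Implicit Types (x t : R) (k n N : nat).
Local Notation mu := (@lebesgue_measure R).
Local Notation c := (@cos_moment R).

Let L : R := ln 2.
Let L_gt0 : 0 < L.
Proof. by rewrite ln_gt0// ltr1n. Qed.

(** Each step uses [cos_momentS] twice. Every even reciprocal comes from two neighbouring steps,
    except the last one, whence the correction [(4 * N%:R)^-1]; it is 0 at [N = 0]. *)
Lemma cos_moment_double N :
  c (2 * N)%N = c 0%N - L^-1 * (half_harmonic N + (4 * N%:R)^-1).
Proof.
elim: N => [|N IH].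
  by rewrite muln0 /half_harmonic big_ord0 mulr0n !mulr0 invr0 addr0 mulr0 subr0.
have h1 := @cos_momentS R (2 * N); have h2 := @cos_momentS R (2 * N).+1.
have -> : (2 * N.+1)%N = (2 * N).+2 by rewrite mulnS.
have -> : c (2 * N).+2 = c (2 * N)%N + (2 * L)^-1 *
    ((2 * N).+2%:R^-1 - 2 * (2 * N).+1%:R^-1 + (2 * N)%N%:R^-1).
  have -> : c (2 * N).+2 = c (2 * N)%N + (c (2 * N).+1 + c (2 * N).+2) -
      (c (2 * N)%N + c (2 * N).+1) by ring.
  by rewrite h1 h2 -/L; ring.
rewrite IH half_harmonicS -(natr1 (2 * N).+1) -(natr1 (2 * N)) -(natr1 N) natrM !invfM.
have [->|N0] := eqVneq N 0%N.
  rewrite mulr0n !(invr0, mulr0, add0r, addr0).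
  by field; rewrite gt_eqF.
have N0' : 0 < N%:R :> R by rewrite ltr0n lt0n.
move: (N%:R) N0' (half_harmonic N) => r r0 u.
have Ln0 : L != 0 by rewrite gt_eqF.
by field; rewrite Ln0 !gt_eqF//; lra.
Qed.

(** Telescopes, as [2 * sin t * cos (2 * n * t) = sin ((2 * n + 1) * t) - sin ((2 * n - 1) * t)]. *)
Lemma sum_cos_double t N :
  2 * sin t * (\sum_(n < N) cos ((2 * n)%N%:R * t)) =
  sin ((2 * N%:R - 1) * t) + sin t.
Proof.
elim: N => [|N IH].
  by rewrite big_ord0 mulr0 mulr0n mulr0 sub0r mulN1r sinN addNr.
rewrite big_ord_recr/= mulrDr IH natrM -(natr1 N).
have -> : (2 * (N%:R + 1) - 1) * t = 2 * N%:R * t + t by ring.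
have -> : (2 * N%:R - 1) * t = 2 * N%:R * t - t by ring.
by rewrite sinB sinD; ring.
Qed.

Lemma sin_angle_neq0 x : -1 < x < 1 -> x != 0 -> sin (angle x) != 0.
Proof.
move=> /andP[x1 x2] x0; have x11 : -1 <= x <= 1 by rewrite !ltW.
rewrite /angle mulr_natl sin_mulr2n sin_acos// acosK ?in_itv//.
rewrite mulrn_eq0/= mulf_neq0// sqrtr_eq0 -ltNge; nra.
Qed.

(** Within [[-1, 1]] the sine vanishes at most at -1, 0 and 1, a Lebesgue-null set. It is the
    exceptional set for the pointwise convergence of the averaged cosines. *)
Lemma muhat_sin_angle_eq0 :
  muhat [set x : measurableTypeR R | sin (angle x) = 0] = 0%E.
Proof.
set N := [set _ | _].
have mN : measurable N.
  have -> : N = (fun x => sin (1%:R * angle x)) @^-1` [set 0].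
    by apply/seteqP; split => x /=; rewrite mul1r.
  rewrite -[X in measurable X]setTI.
  exact: (@measurable_sin_angle R 1 measurableT).
have mNI : measurable (N `&` `[-1, 1]) by exact: measurableI.
apply: null_set_integral => //.
  apply/measurable_EFinP; apply: measurable_funS (measurable_itv _) _ _; last first.
    exact: measurable_muhat_density.
  by move=> x [].
apply/eqP; rewrite eq_le measure_ge0 andbT.
apply: (@le_trans _ _ (mu ([set -1] `|` [set 0] `|` [set 1]))).
  apply: le_measure; rewrite ?inE//; first by apply: measurableU => //; apply: measurableU.
  move=> x [/= sx]; rewrite in_itv/= => /andP[x1 x2].
  have [->|xN1] := eqVneq x (-1); first by left; left.
  have [->|x0] := eqVneq x 0; first by left; right.
  have [->|x1'] := eqVneq x 1; first by right.
  have : -1 < x < 1 by rewrite !lt_neqAle eq_sym xN1 x1 x1' x2.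
  by move=> /sin_angle_neq0 /(_ x0); rewrite sx eqxx.
rewrite (le_trans (measureU2 _ _ _))//; first by apply: measurableU.
rewrite [X in (_ + X)%E](_ : _ = 0%E) ?adde0; last exact: lebesgue_measure_set1.
rewrite (le_trans (measureU2 _ _ _))//.
rewrite [X in (_ + X)%E](_ : _ = 0%E) ?adde0; last exact: lebesgue_measure_set1.
by rewrite [leLHS](_ : _ = 0%E)//; exact: lebesgue_measure_set1.
Qed.

Lemma cvg_mean_cos_moment_double :
  arithmetic_mean (fun n => c (2 * n)%N) @ \oo --> 0.
Proof.
(* [arithmetic_mean] at index [N] averages [N + 1] terms. *)
pose T N x : R := N.+1%:R^-1 * \sum_(n < N.+1) cos ((2 * n)%N%:R * angle x).
have mT N : measurable_fun setT (T N).
  apply: measurable_funM => //; apply: measurable_sum => n.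
  exact: measurable_cos_angle.
have T1 N x : `|T N x| <= 1.
  rewrite normrM ger0_norm ?invr_ge0// ler_pdivrMl ?mulr1//.
  rewrite (le_trans (ler_norm_sum _ _ _))//.
  rewrite (@le_trans _ _ (\sum_(n < N.+1) 1))//; last first.
    by rewrite sumr_const card_ord.
  by apply: ler_sum => n _; exact: norm_cos_le1.
have iT N : (@muhat R).-integrable setT (EFin \o T N).
  by apply: (integrable_muhat (B := 1)).
have TE N : arithmetic_mean (fun n => c (2 * n)%N) N = \int[@muhat R]_x T N x.
  rewrite /arithmetic_mean/= seriesEord/=.
  rewrite /T RintegralZl//; last first.
    apply: (integrable_muhat (B := N.+1%:R)) => [|x].
      by apply: measurable_sum => n; exact: measurable_cos_angle.
    have := T1 N x; rewrite normrM ger0_norm ?invr_ge0// ler_pdivrMl ?mulr1//.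
  congr (_ * _).
  rewrite /Rintegral; under [in RHS]eq_integral do rewrite -sumEFin.
  rewrite integral_sum//; last by move=> n; exact: integrable_cos_angle.
  by rewrite -sum_fine// => n _; exact: integrable_fin_num (integrable_cos_angle _).
(* By [sum_cos_double] the cosine sums are bounded by [|sin (angle x)|^-1] for all [N]. *)
have Tcvg x : sin (angle x) != 0 -> T N x @[N --> \oo] --> 0.
  move=> s0; pose B := `|sin (angle x)|^-1.
  apply: (@squeeze_cvgr _ _ _ _ (fun N => - (B * harmonic N)) (fun N => B * harmonic N)).
  - near=> N; rewrite -ler_norml /T normrM ger0_norm ?invr_ge0// mulrC /harmonic/=.
    rewrite ler_wpM2r ?invr_ge0// /B -[leRHS]mul1r ler_pdivlMr ?normr_gt0//.
    have := sum_cos_double (angle x) N.+1.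
    set S := \sum_(n < _) _ => h.
    have : `|2 * sin (angle x) * S| <= 2.
      rewrite h (le_trans (ler_normD _ _))//.
      by have := norm_sin_le1 (angle x); have := norm_sin_le1 ((2 * N.+1%:R - 1) * angle x); lra.
    by rewrite !normrM ger0_norm// [`|S| * _]mulrC; lra.
  - rewrite -oppr0 -[X in - X](mulr0 B); apply: cvgN; apply: cvgM; first exact: cvg_cst.
    exact: cvg_harmonic.
  - rewrite -[X in _ --> X](mulr0 B); apply: cvgM; first exact: cvg_cst.
    exact: cvg_harmonic.
have [|||||_ _] := @dominated_convergence _ _ _ (@muhat R) setT measurableT
  (fun N x => (T N x)%:E) (cst 0%E) (cst 1%E).
- by move=> N; apply/measurable_EFinP; exact: mT.
- exact: measurable_cst.
- exists [set x : measurableTypeR R | sin (angle x) = 0]; split.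
  + have -> : [set x | sin (angle x) = 0] = (fun x => sin (1%:R * angle x)) @^-1` [set 0].
      by apply/seteqP; split => x /=; rewrite mul1r.
    rewrite -[X in measurable X]setTI.
    exact: (@measurable_sin_angle R 1 measurableT).
  + exact: muhat_sin_angle_eq0.
  + move=> x /= nx; apply/eqP; apply: contrapT => s0; apply: nx => _.
    by apply: cvg_EFin; [exact: nearW|apply: Tcvg; exact/negP].
- by apply/(integrable_muhat (u := cst 1) (B := 1)) => // x; rewrite normr1.
- by apply: aeW => x N _; rewrite lee_fin.
rewrite integral0 => /fine_cvgP[_].
by rewrite (_ : arithmetic_mean _ = (fun N => \int[@muhat R]_x T N x))//; exact/funext.
Unshelve. all: by end_near. Qed.

Lemma cvg_cos_moment_double : c (2 * n)%N @[n --> \oo] --> c 0%N - 1.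
Proof.
have cvg4 : (4 * N%:R)^-1 @[N --> \oo] --> (0 : R).
  rewrite -cvg_shiftS (_ : [sequence _]_n = (fun N => 4^-1 * harmonic N)); last first.
    by apply/funext => N /=; rewrite invfM.
  have : 4^-1 * harmonic N @[N --> \oo] --> 4^-1 * (0 : R).
    by apply: cvgM; [exact: cvg_cst|exact: cvg_harmonic].
  by rewrite mulr0.
have -> : (fun n => c (2 * n)%N) = (fun N => c 0%N -
    L^-1 * (half_harmonic N + (4 * N%:R)^-1)).
  by apply/funext => N; exact: cos_moment_double.
have -> : c 0%N - 1 = c 0%N - L^-1 * (ln 2 + 0).
  by rewrite addr0 mulVf// lt0r_neq0.
apply: cvgB; first exact: cvg_cst.
apply: cvgM; first exact: cvg_cst.
by apply: cvgD; [exact: cvg_half_harmonic|exact: cvg4].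
Qed.

(** Convergence passes to the arithmetic means, so the limits [c 0 - 1] and 0 coincide. This yields
    the total mass of [muhat] without a direct evaluation of the integral of [asin x / x]. *)
Lemma cos_moment0 : c 0%N = 1.
Proof.
have := cvg_unique _ (cesaro cvg_cos_moment_double) cvg_mean_cos_moment_double.
by move=> /(_ (@Rhausdorff R) _) /eqP; rewrite subr_eq0 => /eqP.
Qed.

(* A nonnegative moment would, by [c n < c n.+2] and [c n + c n.+1 < 0], keep all
   later moments away from 0. *)
Lemma cos_moment_lt0 n : c n.+1 < 0.
Proof.
have L20 : 0 < (2 * L)^-1 by rewrite invr_gt0 mulr_gt0.
have add_lt0 k : c k.+1 + c k.+2 < 0.
  by rewrite cos_momentS -/L nmulr_llt0// subr_lt0 ltf_pV2 ?posrE// ltr_nat.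
(* The difference is a multiple of the second difference of the reciprocals, which is positive by
   convexity. *)
have incr k : c k.+1 < c k.+3.
  have h1 := @cos_momentS R k.+1; have h2 := @cos_momentS R k.+2.
  rewrite -subr_gt0.
  have -> : c k.+3 - c k.+1 = (2 * L)^-1 *
      (k.+3%:R^-1 - 2 * k.+2%:R^-1 + k.+1%:R^-1).
    have -> : c k.+3 - c k.+1 = (c k.+2 + c k.+3) - (c k.+1 + c k.+2) by ring.
    by rewrite h1 h2 -/L; ring.
  rewrite mulr_gt0// -(natr1 k.+2) -(natr1 k.+1).
  have : 0 < k.+1%:R :> R by [].
  move: (k.+1%:R) => r r0.
  have -> : (r + 1 + 1)^-1 - 2 * (r + 1)^-1 + r^-1 = 2 / (r * (r + 1) * (r + 1 + 1)) :> R.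
    by field; rewrite !gt_eqF//; lra.
  by rewrite divr_gt0// !mulr_gt0//; lra.
rewrite ltNge; apply/negP => cn0.
pose d := c n.+3; have d0 : 0 < d by exact: le_lt_trans (incr n).
have far m : d <= c (n.+3 + 2 * m)%N.
  elim: m => [|m IH]; first by rewrite muln0 addn0.
  rewrite (le_trans IH)// mulnS addnCA; exact: ltW (incr (n.+2 + 2 * m)%N).
have far' m : c (n.+3 + 2 * m).+1 <= - d.
  by have := far m; have := add_lt0 (n.+2 + 2 * m)%N; rewrite addSn; lra.
(* From index [n.+3] on the moments alternate between values at least [d] and values at most [- d],
   against the convergence of [c (2n)] to 0. *)
have all_far j : (n.+3 <= j)%N -> d <= `|c j|.
  move=> /subnK; rewrite addnC; set k := (j - _)%N => <-.
  rewrite -(odd_double_half k) -mul2n; case: (odd k) => /=.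
    by rewrite add1n addnS -normrN (le_trans _ (ler_norm _))// lerNr far'.
  by rewrite add0n (le_trans _ (ler_norm _))// far.
have /cvgrPdist_lt/(_ _ d0)[N _ hN] := cvg_cos_moment_double.
have /= := hN (maxn N n.+3) (leq_maxl _ _).
rewrite cos_moment0 subrr sub0r normrN ltNge all_far//.
by rewrite (leq_trans (leq_maxr N _))// leq_pmull.
Qed.

(** Adding up [cos_momentS] counts the moments twice. For [N > 0] the boundary term
    [- c N - (2 * L)^-1 * N%:R^-1] is negative, by one more use of the relation and [c N.+1 < 0]. *)
Lemma sum_cos_moment_le N : \sum_(i < N) - c i.+1 <= 1 / 2.
Proof.
have L20 : 0 < (2 * L)^-1 by rewrite invr_gt0 mulr_gt0.
have e : 2 * (\sum_(i < N) - c i.+1) = 1 - c N - (2 * L)^-1 * N%:R^-1.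
  elim: N => [|n IH]; first by rewrite big_ord0 mulr0n invr0 !mulr0 cos_moment0 subrr subr0.
  rewrite big_ord_recr/= mulrDr IH.
  have -> : c n = (c n + c n.+1) - c n.+1 by ring.
  by rewrite cos_momentS -/L; ring.
case: N e => [|N] e; first by rewrite big_ord0; lra.
have h := cos_moment_lt0 N.+1; have h1 := @cos_momentS R N.+1.
have h2 : 0 < (2 * L)^-1 * N.+2%:R^-1 by rewrite mulr_gt0.
rewrite -/L mulrBr in h1.
move: (_ * N.+1%:R^-1) (_ * N.+2%:R^-1) e h1 h2 => p q; lra.
Qed.

End moment_signs.

(** * The Caratheodory function and the Schur iterates *)

Section caratheodory_expansion.
Context {R : realType}.
Local Notation C := (Cx R).
Local Notation W := (fun x : R => circle_lift x : C).
Implicit Types (x B : R) (z w q : C) (g h : R -> C) (n N : nat).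

Lemma continuous_modulus : continuous (fun z : C => modulus z).
Proof.
move=> z; apply: (@continuous_comp C C R (fun z => `|z|)).
  exact: norm_continuous.
exact: continuous_Re.
Qed.

Lemma modulus_circle_lift x : modulus (circle_lift x : C) = 1.
Proof.
apply: ofR_inj; rewrite -modulusE /circle_lift normc_def/= cos2Dsin2 sqrtr1.
by [].
Qed.

Lemma circle_lift_neq0 x : (circle_lift x : C) != 0.
Proof. by rewrite -modulus_eq0 modulus_circle_lift oner_eq0. Qed.

Lemma circle_liftVX x n : (circle_lift x : C)^-1 ^+ n =
  (cos (n%:R * angle x) +i* - sin (n%:R * angle x))%C.
Proof.
rewrite exprVn circle_liftX; set t := _ * _.
have h : (cos t +i* sin t)%C * (cos t +i* - sin t)%C = 1 :> C.
  apply/eqP; rewrite eq_complex/=; apply/andP; split; apply/eqP; last ring.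
  by rewrite mulrN opprK -!expr2 cos2Dsin2.
have n0 : (cos t +i* sin t)%C != 0 :> C.
  by apply: contra_eq_neq h => ->; rewrite mul0r eq_sym oner_eq0.
by apply: (mulfI n0); rewrite mulfV.
Qed.

Definition bounded_measurable g B := [/\ measurable_fun setT (fun x => complex.Re (g x)),
  measurable_fun setT (fun x => complex.Im (g x)) & forall x, modulus (g x) <= B].

Local Notation CI := (Cx_integral (@muhat R) setT).

Lemma integrable_Re g B : bounded_measurable g B ->
  (@muhat R).-integrable setT (EFin \o (fun x => complex.Re (g x))).
Proof.
move=> [mr _ gB]; apply: (integrable_muhat (B := B)) => // x.
exact: le_trans (Re_le_modulus _) (gB x).
Qed.

Lemma integrable_Im g B : bounded_measurable g B ->
  (@muhat R).-integrable setT (EFin \o (fun x => complex.Im (g x))).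
Proof.
move=> [_ mi gB]; apply: (integrable_muhat (B := B)) => // x.
exact: le_trans (Im_le_modulus _) (gB x).
Qed.

Lemma bounded_measurableB g h B B' : bounded_measurable g B ->
  bounded_measurable h B' -> bounded_measurable (fun x => g x - h x) (B + B').
Proof.
move=> [gr gi gB] [hr hi hB]; split.
- rewrite (_ : (fun x => _) = (fun x => complex.Re (g x) - complex.Re (h x))).
    exact: measurable_funB.
  by apply/funext => x; rewrite raddfB.
- rewrite (_ : (fun x => _) = (fun x => complex.Im (g x) - complex.Im (h x))).
    exact: measurable_funB.
  by apply/funext => x; rewrite raddfB.
- by move=> x; rewrite (le_trans (ler_modulusB _ _))// lerD.
Qed.

Lemma Cx_integralB g h B B' : bounded_measurable g B -> bounded_measurable h B' ->
  CI (fun x => g x - h x) = CI g - CI h.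
Proof.
move=> bg bh; rewrite /Cx_integral.
under eq_Rintegral do rewrite raddfB/=.
under [X in (_ +i* X)%C]eq_Rintegral do rewrite raddfB/=.
rewrite RintegralB//; [|exact: integrable_Re bg|exact: integrable_Re bh].
by rewrite RintegralB//; [exact: integrable_Im bg|exact: integrable_Im bh].
Qed.

Lemma bounded_measurableZ z g B : bounded_measurable g B ->
  bounded_measurable (fun x => z * g x) (modulus z * B).
Proof.
move=> [gr gi gB]; split.
- rewrite (_ : (fun x => _) = (fun x => complex.Re z * complex.Re (g x) -
    complex.Im z * complex.Im (g x))).
    by apply: measurable_funB; exact: measurable_funM.
  by apply/funext => x; case: z (g x) => a b [].
- rewrite (_ : (fun x => _) = (fun x => complex.Re z * complex.Im (g x) +
    complex.Im z * complex.Re (g x))).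
    by apply: measurable_funD; exact: measurable_funM.
  by apply/funext => x; case: z (g x) => a b [].
- by move=> x; rewrite modulusM ler_wpM2l// modulus_ge0.
Qed.

Lemma Cx_integralZ z g B : bounded_measurable g B ->
  CI (fun x => z * g x) = z * CI g.
Proof.
move=> bg; rewrite /Cx_integral.
have ir := integrable_Re bg; have ii := integrable_Im bg.
have zr (a : R) (u : R -> R) : (@muhat R).-integrable setT (EFin \o u) ->
    (@muhat R).-integrable setT (EFin \o (fun x => a * u x)).
  by move=> iu; apply: eq_integrable (integrableZl measurableT a iu).
rewrite (_ : (fun x => complex.Re _) = (fun x => complex.Re z * complex.Re (g x) -
    complex.Im z * complex.Im (g x))); last first.
  by apply/funext => x; case: z (g x) => a b [].
rewrite (_ : (fun x => complex.Im _) = (fun x => complex.Re z * complex.Im (g x) +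
    complex.Im z * complex.Re (g x))); last first.
  by apply/funext => x; case: z (g x) => a b [].
rewrite RintegralB ?RintegralD//; [|exact: zr..].
by rewrite !RintegralZl//; case: z.
Qed.

Lemma muhat_setT : fine (@muhat R setT) = 1.
Proof.
rewrite -(@cos_moment0 R) /cos_moment; under eq_Rintegral do rewrite mul0r cos0.
by rewrite Rintegral_cst// mul1r.
Qed.

Lemma norm_Rintegral_muhat_le (u : R -> R) B : measurable_fun setT u ->
  (forall x, `|u x| <= B) -> `|\int[@muhat R]_x u x| <= B.
Proof.
move=> mu uB; have iu := integrable_muhat mu uB.
rewrite (le_trans (le_normr_Rintegral _ _))//.
rewrite -[leRHS]mulr1 -muhat_setT -(Rintegral_cst _ measurableT).
apply: le_Rintegral => //.
- exact: integrable_norm.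
- apply: (integrable_muhat (u := cst B) (B := `|B|)) => //.
Qed.

(** The total mass is 1; the factor 2 comes from bounding real and imaginary parts separately. *)
Lemma modulus_Cx_integral_le g B : bounded_measurable g B -> modulus (CI g) <= 2 * B.
Proof.
move=> [gr gi gB]; rewrite (le_trans (ler_modulus_ReIm _))//= mulr_natl lerD//.
  apply: norm_Rintegral_muhat_le => // x; exact: le_trans (Re_le_modulus _) (gB x).
apply: norm_Rintegral_muhat_le => // x; exact: le_trans (Im_le_modulus _) (gB x).
Qed.

Lemma bounded_measurable_circle_liftVX n :
  bounded_measurable (fun x => (W x)^-1 ^+ n) 1.
Proof.
split.
- rewrite (_ : (fun x => _) = (fun x => cos (n%:R * angle x))).
    exact: measurable_cos_angle.
  by apply/funext => x; rewrite circle_liftVX.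
- rewrite (_ : (fun x => _) = (fun x => - sin (n%:R * angle x))).
    by apply: measurableT_comp => //; exact: measurable_sin_angle.
  by apply/funext => x; rewrite circle_liftVX.
- by move=> x; rewrite modulusX modulusV modulus_circle_lift invr1 expr1n.
Qed.

(** The kernel expands in powers of [z / w], hence the inverse powers; the moments are real because
    the sine moments vanish. *)
Lemma Cx_integral_circle_liftVX n : CI (fun x => (W x)^-1 ^+ n) = ofR (@cos_moment R n).
Proof.
rewrite /Cx_integral /cos_moment.
under eq_Rintegral do rewrite circle_liftVX/=.
under [X in (_ +i* X)%C]eq_Rintegral do rewrite circle_liftVX/= -mulN1r.
rewrite RintegralZl//; last exact: integrable_sin_angle.
by rewrite -/(@sin_moment R n) sin_moment_eq0 mulr0.
Qed.

Lemma continuous_kernel z w : w != z ->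
  {for w, continuous (fun w : C => (w + z) / (w - z))}.
Proof.
move=> wz.
have F : Filter (nbhs (w : C)) := nbhs_filter (w : C).
have id_w : (fun w : C => w) @ nbhs w --> w by exact: cvg_id.
apply: (@cvgM C C (nbhs w) F (fun w => w + z) (fun w => (w - z)^-1)).
  by apply: (@cvgD C C C (nbhs w) F id (cst z)); [exact: id_w|exact: cvg_cst].
apply: (@cvgV C C (nbhs w) F (fun w => w - z)); first by rewrite subr_eq0.
by apply: (@cvgB C C C (nbhs w) F id (cst z)); [exact: id_w|exact: cvg_cst].
Qed.

Lemma open_neq_Cx z : open [set w : C | w != z].
Proof.
rewrite (_ : [set w | _] = ~` [set z]); last first.
  by apply/seteqP; split => w /= /eqP.
apply: closed_openC; apply: accessible_closed_set1; apply: hausdorff_accessible.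
exact: norm_hausdorff.
Qed.

(** The remainder is exactly [2 * q ^+ N / (1 - q)] for [N > 0] and [(1 + q) / (1 - q)] for [N = 0],
    and [|1 - q| >= 1 / 2]. *)
Lemma modulus_kernel_le q N : modulus q <= 1 / 2 ->
  modulus ((1 + q) / (1 - q) - \sum_(k < N) ofR (if k == 0 :> nat then 1 else 2) * q ^+ k)
  <= 4 * modulus q ^+ N.
Proof.
move=> q2; have q0 := modulus_ge0 q.
have d : 1 / 2 <= modulus (1 - q).
  have := ler_modulusD (1 - q) q.
  rewrite subrK -[X in modulus X <= _ -> _](rmorph1 ofR) modulus_ofR normr1; lra.
have d0 : 1 - q != 0 by rewrite -modulus_eq0 gt_eqF//; lra.
have -> : (1 + q) / (1 - q) -
    \sum_(k < N) ofR (if k == 0 :> nat then 1 else 2) * q ^+ k =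
    (if N == 0%N then 1 + q else 2 * q ^+ N) / (1 - q).
  case: N => [|N]; first by rewrite big_ord0 subr0.
  elim: N => [|N IH]; first by rewrite big_ord1/= rmorph1 expr0 expr1; field.
  rewrite big_ord_recr/= opprD addrA IH/= [q ^+ N.+2]exprS rmorph_nat; field.
  by [].
rewrite modulusM modulusV ler_pdivrMr; last lra.
have m2 : modulus (2 : C) = 2 by rewrite -(rmorph_nat ofR) modulus_ofR normr_nat.
case: N => [|N]/=.
  rewrite expr0 mulr1 (le_trans (ler_modulusD _ _))//.
  rewrite -[X in modulus X](rmorph1 ofR) modulus_ofR normr1; lra.
rewrite modulusM modulusX m2.
have : 0 <= modulus q ^+ N.+1 by rewrite exprn_ge0.
nra.
Qed.

Lemma circle_lift_subr_neq0 z x : modulus z <= 1 / 2 -> W x != z.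
Proof.
move=> z2; apply/eqP => e; have := modulus_circle_lift x.
by rewrite e; lra.
Qed.

Lemma kernelE z x : W x != z ->
  (W x + z) / (W x - z) = (1 + z * (W x)^-1) / (1 - z * (W x)^-1).
Proof.
move=> wz; have w0 := circle_lift_neq0 x; rewrite -subr_eq0 in wz.
by field; rewrite wz w0.
Qed.

Lemma bounded_measurable_kernel z : modulus z <= 1 / 2 ->
  bounded_measurable (fun x => (W x + z) / (W x - z)) 4.
Proof.
move=> z2; split.
- apply: (@measurable_circle_lift_comp R [set w : C | w != z]
    (fun w => complex.Re ((w + z) / (w - z)))).
  + exact: open_neq_Cx.
  + move=> w /[!inE]/= wz; apply: (@continuous_comp C C R (fun w => (w + z) / (w - z))).
      exact: continuous_kernel.
    exact: continuous_Re.
  + by move=> x; exact: circle_lift_subr_neq0.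
- apply: (@measurable_circle_lift_comp R [set w : C | w != z]
    (fun w => complex.Im ((w + z) / (w - z)))).
  + exact: open_neq_Cx.
  + move=> w /[!inE]/= wz; apply: (@continuous_comp C C R (fun w => (w + z) / (w - z))).
      exact: continuous_kernel.
    exact: continuous_Im.
  + by move=> x; exact: circle_lift_subr_neq0.
- move=> x; rewrite kernelE; last exact: circle_lift_subr_neq0.
  have := @modulus_kernel_le (z * (W x)^-1) 0.
  rewrite modulusM modulusV modulus_circle_lift invr1 mulr1 => /(_ z2).
  by rewrite big_ord0 subr0 expr0 mulr1.
Qed.

Lemma measurable_unit_circle : measurable (@unit_circle R).
Proof.
rewrite (_ : unit_circle = setT `&` (fun w : C => modulus w) @^-1` [set 1]).
  have h := @open_continuous_measurable_Cx R setT (fun w => modulus w) openT.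
  apply: h => // w _; exact: continuous_modulus.
rewrite setTI; apply/seteqP; split => w; rewrite /unit_circle/= modulusE.
  by move=> e; apply: ofR_inj; rewrite e rmorph1.
by move=> ->; rewrite rmorph1.
Qed.

(** Used with [k] the real or the imaginary part. The lift takes values on the unit circle, so the
    restriction to it disappears under the pushforward, and the pole [z] lies inside the disc. *)
Lemma Rintegral_sigma (z : C) (k : C -> R) : modulus z <= 1 / 2 ->
  continuous k ->
  (@muhat R).-integrable setT (EFin \o (fun x => k ((W x + z) / (W x - z)))) ->
  \int[@sigma R]_(w in unit_circle) k (((w : C) + z) / ((w : C) - z)) =
  \int[@muhat R]_x k ((W x + z) / (W x - z)).
Proof.
move=> z2 ck ik; rewrite /Rintegral; congr fine.
pose D : set (BorelCx R) := [set w : C | w != z].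
pose g : BorelCx R -> R := fun w : C => k ((w + z) / (w - z)).
(* The change of variables asks for measurability on the whole plane, so the kernel is set to 0 at
   its pole. *)
pose f : BorelCx R -> R := g \_ D.
have mD : measurable D by apply: sub_sigma_algebra; exact: open_neq_Cx.
have circD w : unit_circle w -> D w.
  move=> /= uw; apply/eqP => e; move: uw; rewrite /unit_circle/= e modulusE.
  by rewrite -(rmorph1 ofR) => /ofR_inj; lra.
have mf : measurable_fun setT f.
  suff mg : measurable_fun D g by exact: (iffLR (measurable_restrictT g mD) mg).
  apply: (@open_continuous_measurable_Cx R D g); first exact: open_neq_Cx.
  move=> w /[!inE]/= wz; apply: (@continuous_comp C C R (fun w => (w + z) / (w - z))).
    exact: continuous_kernel.
  exact: ck.
have circT : (@circle_lift R) @^-1` unit_circle = setT.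
  apply/seteqP; split => // x _; rewrite /= /unit_circle/= modulusE.
  by rewrite modulus_circle_lift rmorph1.
have fW x : f (circle_lift x) = k ((W x + z) / (W x - z)).
  by rewrite /f patchE mem_set//; exact: circle_lift_subr_neq0.
transitivity (\int[@sigma R]_(w in unit_circle) (f w)%:E)%E.
  apply: eq_integral => w /[!inE] uw; rewrite /f patchE mem_set//; exact: circD.
have mfE : measurable_fun setT (EFin \o f) by exact/measurable_EFinP.
have ifW : (@muhat R).-integrable (@circle_lift R @^-1` unit_circle)
    ((EFin \o f) \o @circle_lift R).
  rewrite circT; apply: eq_integrable ik => // x _ /=.
  by rewrite fW.
have := @integral_pushforward _ _ (measurableTypeR R) (BorelCx R) R (@circle_lift R)
  (@measurable_circle_lift R) (@muhat R) unit_circle (EFin \o f) mfE ifW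
  measurable_unit_circle.
move=> h; apply: (etrans h).
by rewrite circT; apply: eq_integral => x _ /=; rewrite fW.
Qed.

Lemma has_power_series_caratheodory :
  has_power_series (@caratheodory R)
    (fun k => (if k == 0%N then 1 else 2) * @cos_moment R k).
Proof.
pose e k : R := if k == 0%N then 1 else 2.
have e2 k : `|e k| <= 2 by rewrite /e; case: ifP => _; rewrite ?normr1 ?normr_nat ?ler1n.
(* The 8 is the 4 of [modulus_kernel_le] times the 2 of [modulus_Cx_integral_le]. *)
exists 8, 1; split => //.
- move=> k; rewrite normrM expr1n mulr1.
  have : `|@cos_moment R k| <= 1.
    apply: norm_Rintegral_muhat_le; first exact: measurable_cos_angle.
    by move=> x; exact: norm_cos_le1.
  have := e2 k; have := normr_ge0 (e k); have := normr_ge0 (@cos_moment R k).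
  rewrite /e; nra.
move=> z N; rewrite mul1r => z2.
pose ker x : C := (W x + z) / (W x - z).
pose part N x : C := ker x - \sum_(k < N) ofR (e k) * (z * (W x)^-1) ^+ k.
have bk : bounded_measurable ker 4 by exact: bounded_measurable_kernel.
have cE : caratheodory z = CI ker.
  rewrite /caratheodory /Cx_integral Rintegral_sigma//; last 2 first.
  - exact: continuous_Re.
  - exact: integrable_Re bk.
  rewrite Rintegral_sigma//; first exact: continuous_Im.
  exact: integrable_Im bk.
(* The bound [B] grows along the induction and only ensures integrability; the kernel estimate takes
   its place afterwards. *)
have [B [[pr pi _] pE]] : exists B, bounded_measurable (part N) B /\
    CI (part N) = caratheodory z - \sum_(k < N) ofR (e k * @cos_moment R k) * z ^+ k.
  elim: N => [|n [B [bB IH]]].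
    exists 4; rewrite big_ord0 subr0 (_ : part 0%N = ker)//.
    by apply/funext => x; rewrite /part big_ord0 subr0.
  have bt := bounded_measurableZ (ofR (e n) * z ^+ n) (bounded_measurable_circle_liftVX n).
  have -> : part n.+1 = (fun x => part n x - ofR (e n) * z ^+ n * (W x)^-1 ^+ n).
    by apply/funext => x; rewrite /part big_ord_recr/= exprMn; ring.
  exists (B + modulus (ofR (e n) * z ^+ n) * 1); split; first exact: bounded_measurableB.
  rewrite (Cx_integralB bB bt) IH (Cx_integralZ _ (bounded_measurable_circle_liftVX n)).
  by rewrite Cx_integral_circle_liftVX big_ord_recr/= rmorphM/=; ring.
rewrite -pE; have -> : 8 * modulus z ^+ N = 2 * (4 * modulus z ^+ N).
  by rewrite mulrA -natrM.
apply: modulus_Cx_integral_le; split => // x.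
rewrite /part /ker kernelE; last exact: circle_lift_subr_neq0.
have qz : modulus (z * (W x)^-1) = modulus z.
  by rewrite modulusM modulusV modulus_circle_lift invr1 mulr1.
have := @modulus_kernel_le (z * (W x)^-1) N.
by rewrite qz; apply.
Qed.

End caratheodory_expansion.

(** * The Schur algorithm on series with negative coefficients *)

Section schur_iterates.
Context {R : realType}.
Local Notation C := (Cx R).
Implicit Types (x : R) (f : C -> C) (a b : nat -> R) (j k n N : nat).

Lemma conj_ofR x : (ofR x)^* = ofR x :> C.
Proof.
by apply: conj_Creal; rewrite realE -[0]/(ofR 0) !ler_ofR; exact: num_real.
Qed.

(** The invariant of the Schur algorithm, stated for the coefficients of [- f]. *)
Definition positive_le1 a := (forall n, 0 < a n) /\ (forall N, \sum_(n < N) a n <= 1).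

Lemma positive_le1_norm a n : positive_le1 a -> `|- a n| <= 1.
Proof.
move=> [a0 a1]; rewrite normrN gtr0_norm//.
apply: le_trans (a1 n.+1); rewrite big_ord_recr/= lerDr.
by apply: sumr_ge0 => i _; exact: ltW.
Qed.

Lemma schur_step f a : positive_le1 a -> has_power_series f (fun k => - a k) ->
  exists2 b, positive_le1 b & has_power_series (remove_singularity
    (fun z => (f z - f 0) / (z * (1 - (f 0)^* * f z)))) (fun k => - b k).
Proof.
move=> [a_gt0 a_le1] fa; have f0 := has_power_series_at0 fa.
have tail_le N : \sum_(i < N) a i.+1 <= 1 - a 0%N.
  by have := a_le1 N.+1; rewrite big_ord_recl/=; lra.
(* Strict because [a 1] is positive and counts in the same sum. *)
have a01 : a 0%N < 1.
  by have := tail_le 1%N; rewrite big_ord1; have := a_gt0 1%N; lra.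
have pE := has_power_series_affine (a 0%N) 1 fa.
have qE := has_power_series_affine 1 (a 0%N) fa.
have a0 := a_gt0 0%N.
(* The denominator has constant term [1 - a 0 ^+ 2], and its other coefficients total at most
   [delta = a 0 * (1 - a 0)] in absolute value. So [d 0 - delta = 1 - a 0], which is the bound
   [tail_le] on the numerator. *)
have [|||||b [b_gt0 b_le1 bE]] := @quotient_coefs_gt0_le1 R
  (fun k => 1 *+ (k == 0)%N + a 0%N * - a k) (fun n => a n.+1)
  (a 0%N * (1 - a 0%N)).
- by move=> i /=; rewrite mulr0n add0r mulrN oppr_le0 mulr_ge0// ltW.
- by move=> n.
- move=> N /=; under eq_bigr do rewrite mulr0n add0r mulrN opprK.
  by rewrite -mulr_sumr; apply: ler_wpM2l (tail_le N); exact: ltW.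
- by rewrite /= mulr1n; nra.
- by move=> N /=; rewrite mulr1n (le_trans (tail_le N))//; lra.
exists b => //.
have -> : (fun z => (f z - f 0) / (z * (1 - (f 0)^* * f z))) =
    (fun z => (ofR (a 0%N) + ofR 1 * f z) / (z * (ofR 1 + ofR (a 0%N) * f z))).
  apply/funext => z; rewrite f0 conj_ofR rmorphN rmorph1 opprK mul1r mulNr opprK.
  by rewrite addrC.
apply: has_power_series_div pE qE _ _ _ _.
- by rewrite /= mulr1n; ring.
- by rewrite /= mulr1n gt_eqF//; nra.
- by move=> n; exact: positive_le1_norm.
- move=> n; rewrite /= mulr0n add0r mul1r -bE -sumrN.
  by apply: eq_bigr => i _; rewrite mulNr.
Qed.

Lemma schur_function_coefs : exists2 b, positive_le1 b &
  has_power_series (@schur_function R) (fun k => - b k).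
Proof.
have Fa := @has_power_series_caratheodory R.
have pE := has_power_series_affine (-1) 1 Fa.
have qE := has_power_series_affine 1 1 Fa.
have c_lt0 := @cos_moment_lt0 R.
have sum2 N : \sum_(i < N) - (2 * @cos_moment R i.+1) <= 1.
  under eq_bigr do rewrite -mulrN.
  by rewrite -mulr_sumr; have := @sum_cos_moment_le R N; lra.
(* As [c 0 = 1], the denominator [F + 1] has constant term 2, and [sum2] bounds both its other
   coefficients and the numerator by [delta = 1 = d 0 - delta]. *)
have [|||||b [b_gt0 b_le1 bE]] := @quotient_coefs_gt0_le1 R
  (fun k => 1 *+ (k == 0)%N + 1 * ((if k == 0%N then 1 else 2) * @cos_moment R k))
  (fun n => - (2 * @cos_moment R n.+1)) 1.
- by move=> i /=; rewrite mulr0n add0r mul1r pmulr_rle0 ?ltW ?c_lt0.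
- by move=> n; rewrite oppr_gt0 pmulr_rlt0 ?c_lt0.
- by move=> N /=; under eq_bigr do rewrite mulr0n add0r mul1r; exact: sum2.
- by rewrite /= cos_moment0; lra.
- by move=> N /=; rewrite (le_trans (sum2 N))// cos_moment0; lra.
exists b => //; rewrite /schur_function.
have -> : (fun z => (caratheodory z - 1) / (z * (caratheodory z + 1))) =
    (fun z : C => (ofR (-1) + ofR 1 * caratheodory z) /
                  (z * (ofR 1 + ofR 1 * caratheodory z))).
  by apply/funext => z; rewrite rmorphN rmorph1 mul1r addrC [1 + _]addrC.
apply: has_power_series_div pE qE _ _ _ _.
- by rewrite /= cos_moment0; lra.
- by rewrite /= cos_moment0 gt_eqF//; lra.
- by move=> n; exact: positive_le1_norm.
- move=> n; rewrite /= mulr0n add0r mul1r -[RHS]opprK -bE -sumrN.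
  by apply: eq_bigr => i _; rewrite mulNr.
Qed.

Lemma schur_iterate_coefs j : exists2 b, positive_le1 b &
  has_power_series (@schur_iterate R j) (fun k => - b k).
Proof.
elim: j => [|j [a a1 fa]]; first exact: schur_function_coefs.
exact: schur_step a1 fa.
Qed.

End schur_iterates.

Theorem theorem2p4 (R : realType) :
  (forall j n : nat, taylor_coefficient (@schur_iterate R j) n < 0) /\
  (forall j : nat, -1 < @schur_parameter R j < 0).
Proof.
split=> [j n|j]; have [b [b_gt0 b_le1] fb] := @schur_iterate_coefs R j.
  by rewrite (taylor_coefficient_power_series n fb) -[0]/(ofR 0) ltr_ofR oppr_lt0.
rewrite /schur_parameter (has_power_series_at0 fb).
rewrite -[0]/(ofR 0) -(rmorph1 ofR) -rmorphN !ltr_ofR oppr_lt0 b_gt0 andbT ltrN2.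
(* From [b 0 + b 1 <= 1] and [b 1 > 0], the inequality [b 0 < 1] is strict. *)
by have := b_le1 2%N; rewrite big_ord_recr big_ord1/=; have := b_gt0 1%N; lra.
Qed.
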